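(* Let $d_1>d_2\ge1$ be integers, let $\boldsymbol\Sigma_{\boldsymbol\varepsilon}\in\mathbb R^{(d_1-d_2)\times(d_1-d_2)}$ be positive definite, and let $\tilde{\boldsymbol G}:[0,1]^{d_2}\to\mathbb R^{d_1-d_2}$ be such that there exists $0\le L<\infty$ with $$\left\|\frac{\partial^{|u|}\tilde{\boldsymbol G}}{\prod_{j\in u}\partial z_j}(\boldsymbol z)\right\|_2\le L\quad\text{for all }\boldsymbol z\in[0,1]^{d_2}\text{ and all }u\subseteq\{1,\dots,d_2\},$$ and $\|\tilde{\boldsymbol G}(\boldsymbol z)-\tilde{\boldsymbol G}(\boldsymbol z')\|_2\le L\|\boldsymbol z-\boldsymbol z'\|_2$ for $\boldsymbol z,\boldsymbol z'\in[0,1]^{d_2}$. Let $f=\log$, let $g:[0,1]^{d_1}\times[0,1]^{d_2}\to\mathbb R_+$ be $$g(\boldsymbol y,\boldsymbol x)=\frac{1}{\det(2\pi\boldsymbol\Sigma_{\boldsymbol\varepsilon})^{1/2}}\exp\left(-\frac12\left\|\tilde{\boldsymbol G}(\boldsymbol y_1)+\boldsymbol\Sigma_{\boldsymbol\varepsilon}^{1/2}\Phi^{-1}(\boldsymbol y_2)-\tilde{\boldsymbol G}(\boldsymbol x)\right\|^2_{\boldsymbol\Sigma_{\boldsymbol\varepsilon}^{-1}}\right),$$ where $\boldsymbol y=(\boldsymbol y_1,\boldsymbol y_2)$, $\boldsymbol y_1,\boldsymbol x\in[0,1]^{d_2}$, $\boldsymbol y_2\in[0,1]^{d_1-d_2}$,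 and define $\tilde f(\boldsymbol y)=f\left(\int_{[0,1]^{d_2}}g(\boldsymbol y,\boldsymbol x)\,\mathrm d\boldsymbol x\right)$. Then for any $A_i>0$, $1\le i\le d_1$, there exists $0<b<\infty$ such that $$\left|\frac{\partial^{|u|}\tilde f}{\prod_{j\in u}\partial y_j}(\boldsymbol y)\right|\le b\prod_{i=1}^{d_1}\min(y_i,1-y_i)^{-A_i-\mathbf 1\{i\in u\}}$$ for all $\boldsymbol y\in(0,1)^{d_1}$ and all $u\subseteq\{1,\dots,d_1\}$.
   Context: $\Phi^{-1}$ is the inverse cumulative distribution function of the standard normal distribution, applied componentwise in dimension $d_1-d_2$; $\|\boldsymbol v\|^2_{\boldsymbol\Sigma^{-1}}=\boldsymbol v^{\top}\boldsymbol\Sigma^{-1}\boldsymbol v$. For $u=\emptyset$ the mixed derivative of a function is the function itself. *)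

(* Defs.v *)
From HB Require Import structures.
From mathcomp Require Import all_boot all_order all_algebra.
From mathcomp Require Import all_classical all_reals all_analysis.

Set Implicit Arguments.
Unset Strict Implicit.
Unset Printing Implicit Defensive.

Import Order.TTheory GRing.Theory Num.Theory.
Import numFieldNormedType.Exports.

Local Open Scope classical_set_scope.
Local Open Scope ring_scope.

Section cons_measure.
Context d (T : measurableType d) (R : realType) (n : nat).
Variables (mu : {sigma_finite_measure set T -> \bar R})
  (nu : {sigma_finite_measure set (n.-tuple T) -> \bar R}).

Definition tuple_cons (xt : T * n.-tuple T) : n.+1.-tuple T :=
  [the n.+1.-tuple T of xt.1 :: xt.2].

Lemma measurable_tuple_cons : measurable_fun [set: T * n.-tuple T] tuple_cons.
Proof. exact: (measurable_cons measurable_fst measurable_snd). Qed.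

Definition cons_measure : set (n.+1.-tuple T) -> \bar R :=
  pushforward (mu \x nu)%E tuple_cons.

Let cons_measure0 : cons_measure set0 = 0%E.
Proof. by rewrite /cons_measure /pushforward preimage_set0 measure0. Qed.

Let cons_measure_ge0 A : (0 <= cons_measure A)%E.
Proof. exact: (@measure_ge0 _ _ _ (mu \x nu)%E). Qed.

Let cons_measure_semi_sigma_additive : semi_sigma_additive cons_measure.
Proof.
move=> F mF tF mUF; rewrite /cons_measure /pushforward preimage_bigcup.
have mcons A : measurable A -> measurable (tuple_cons @^-1` A).
  by move=> mA; rewrite -[X in measurable X]setTI; exact: measurable_tuple_cons.
apply: measure_semi_sigma_additive.
- by move=> k; exact: mcons.
- apply/trivIsetP => /= i j _ _ ij; rewrite -preimage_setI.
  by move/trivIsetP : tF => /(_ _ _ _ _ ij) ->//; rewrite preimage_set0.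
- by rewrite -preimage_bigcup; exact: mcons.
Qed.

HB.instance Definition _ := isMeasure.Build _ _ _ cons_measure
  cons_measure0 cons_measure_ge0 cons_measure_semi_sigma_additive.

Let cons_measure_sigma_finite : sigma_finite [set: n.+1.-tuple T] cons_measure.
Proof.
pose uncons (t : n.+1.-tuple T) : T * n.-tuple T :=
  (tnth t ord0, [tuple of behead t]).
have muncons : measurable_fun setT uncons.
  apply: measurable_fun_pair; first exact: measurable_tnth.
  exact: measurable_behead.
have [H HT Hfin] : sigma_finite [set: T * n.-tuple T] (mu \x nu)%E.
  have /sigma_finiteP[F [FT ndF Foo]] := sigma_finiteT mu.
  have /sigma_finiteP[G [GT ndG Goo]] := sigma_finiteT nu.
  exists (fun k => F k `*` G k).
    rewrite -setXTT FT GT predeqE => -[x t]; split.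
      move=> [/= [i _ Fix] [k _ Gkt]]; exists (maxn i k) => //; split.
      - by move: x Fix; exact/subsetPset/ndF/leq_maxl.
      - by move: t Gkt; exact/subsetPset/ndG/leq_maxr.
    by move=> [k _ []/= ? ?]; split; exists k.
  move=> k; have [? ?] := Foo k; have [? ?] := Goo k.
  split; first exact: measurableX.
  by rewrite product_measure1E// lte_mul_pinfty// ge0_fin_numE.
exists (fun k => uncons @^-1` H k).
  by rewrite -preimage_bigcup -HT preimage_setT.
move=> k; have [mHk Hkoo] := Hfin k; split.
  by rewrite -[X in measurable X]setTI; exact: muncons.
rewrite /cons_measure /pushforward -comp_preimage.
rewrite (_ : uncons \o tuple_cons = id) ?preimage_id//.
apply/funext => -[x t]; congr pair => /=.
by apply/val_inj.
Qed.

HB.instance Definition _ := Measure_isSigmaFinite.Build _ _ _ cons_measure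
  cons_measure_sigma_finite.

End cons_measure.

(* n-dimensional Lebesgue measure on the product sigma-algebra of n.-tuple R. *)
Fixpoint lebesgue_tuple (R : realType) (n : nat) :
    {sigma_finite_measure set (n.-tuple (measurableTypeR R)) -> \bar R} :=
  match n with
  | 0%N => \d_([tuple] : 0.-tuple (measurableTypeR R))
  | n'.+1 => cons_measure (@lebesgue_measure R) (lebesgue_tuple R n')
  end.

Lemma measurable_box d (T : measurableType d) (n : nat) (B : 'I_n -> set T) :
  (forall i, measurable (B i)) ->
  measurable [set t : n.-tuple T | forall i, B i (tnth t i)].
Proof.
move=> mB.
rewrite (_ : [set _ | _] = \bigcap_(i in [set: 'I_n]) ((@tnth n T)^~ i @^-1` B i)).
  apply: fin_bigcap_measurable => // i _.
  by rewrite -[X in measurable X]setTI; exact: measurable_tnth.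
by apply/seteqP; split=> [t Bt i _|t Bt i]; [exact: Bt|exact: (Bt i I)].
Qed.

Lemma lebesgue_tuple_box (R : realType) (n : nat)
    (B : 'I_n -> set (measurableTypeR R)) :
  (forall i, measurable (B i)) ->
  lebesgue_tuple R n [set t | forall i, B i (tnth t i)] =
  (\prod_(i < n) lebesgue_measure (B i))%E.
Proof.
elim: n B => [|n IH] B mB /=.
  rewrite big_ord0 diracE mem_set//= => -[]//.
rewrite big_ord_recl -IH => [|i]; last exact: mB.
have mC : measurable [set t : n.-tuple (measurableTypeR R) |
    forall i, B (lift ord0 i) (tnth t i)].
  by apply: (@measurable_box _ _ n (fun i => B (lift ord0 i))) => i; exact: mB.
rewrite -product_measure1E//.
rewrite /cons_measure /pushforward; congr (product_measure1 _ _ _).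
apply/seteqP; split=> [[x t] /= Bxt|[x t] /= [Bx Bt] i].
  split=> [|i]; first by have := Bxt ord0; rewrite (tnth_nth x).
  by have := Bxt (lift ord0 i); rewrite !(tnth_nth x).
case: (unliftP ord0 i) => [j ->|->]; last by rewrite (tnth_nth x).
by have := Bt j; rewrite !(tnth_nth x).
Qed.

Section vectors.
Context (R : realType) (n : nat).
Implicit Types (v : 'cV[R]_n) (S : 'M[R]_n).

Definition cV_of_tuple (t : n.-tuple R) : 'cV[R]_n := \col_i tnth t i.

(* The canonical norm on 'cV[R]_n is the sup norm. *)
Definition l2norm v : R := Num.sqrt (\sum_i v i 0 ^+ 2).

Definition closed_cube : set 'cV[R]_n := [set v | forall i, 0 <= v i 0 <= 1].

Definition open_cube : set 'cV[R]_n := [set v | forall i, 0 < v i 0 < 1].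

Definition cube_integral (f : 'cV[R]_n -> R) : R :=
  \int[lebesgue_tuple R n]_(t in cV_of_tuple @^-1` closed_cube)
    f (cV_of_tuple t).

Definition posdefmx S : Prop :=
  S^T = S /\ forall v, v != 0 -> 0 < (v^T *m S *m v) 0 0.

(* The unique positive definite square root, when S is positive definite. *)
Definition sqrtmx S : 'M[R]_n := xget 0 [set Q | posdefmx Q /\ Q *m Q = S].

(* The squared norm of v with respect to the inverse of S. *)
Definition invmx_norm2 S v : R := (v^T *m invmx S *m v) 0 0.

End vectors.

Section mixed_partial_derivatives.
Context (R : realType) (n : nat) (V : normedModType R).
Implicit Types (E : set 'cV[R]_n) (F : 'cV[R]_n -> V).

(* Only increments that stay in E are used: one-sided on the faces of a closed
   cube, and the ordinary partial derivative when E is open. *)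
Definition partial_within E F (j : 'I_n) (z : 'cV[R]_n) (l : V) : Prop :=
  h^-1 *: (F (z + h *: delta_mx j 0) - F z)
    @[h --> within [set h | E (z + h *: delta_mx j 0)] 0^'] --> l.

(* D u is the mixed partial derivative of F on E with respect to the variables
   in u, each taken once, in whatever order they are taken. *)
Definition mixed_partials E F (D : {set 'I_n} -> 'cV[R]_n -> V) : Prop :=
  (forall z, E z -> D finset.set0 z = F z) /\
  (forall (u : {set 'I_n}) (j : 'I_n) z, j \notin u -> E z ->
    partial_within E (D u) j z (D (j |: u) z)).

End mixed_partial_derivatives.

Section standard_normal.
Context (R : realType).

Definition std_normal_cdf (x : R) : R := fine (normal_prob 0 1 `]-oo, x]).

(* Set to 0 outside of ]0, 1[, in particular at 0 and 1 where the inverse is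
   infinite. *)
Definition std_normal_icdf : R -> R := 'pinv_(fun=> 0) [set: R] std_normal_cdf.

End standard_normal.

Section likelihood.
Context (R : realType) (d1 d2 : nat) (d21 : (d2 < d1)%N).

Definition fst_block (y : 'cV[R]_d1) : 'cV[R]_d2 :=
  \col_j y (widen_ord (ltnW d21) j) 0.

Definition snd_block (y : 'cV[R]_d1) : 'cV[R]_(d1 - d2) :=
  \col_k y (cast_ord (subnKC (ltnW d21)) (rshift d2 k)) 0.

Variables (Sigma : 'M[R]_(d1 - d2)) (G : 'cV[R]_d2 -> 'cV[R]_(d1 - d2)).

Definition likelihood (y : 'cV[R]_d1) (x : 'cV[R]_d2) : R :=
  (Num.sqrt (\det ((2 * pi) *: Sigma)))^-1 *
  expR (- 2^-1 * invmx_norm2 Sigma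
    (G (fst_block y) + sqrtmx Sigma *m map_mx (@std_normal_icdf R) (snd_block y)
     - G x)).

Definition log_evidence (y : 'cV[R]_d1) : R :=
  ln (cube_integral (likelihood y)).

End likelihood.

(* Main.v *)
Require Import Defs.
From HB Require Import structures.
From mathcomp Require Import all_boot all_order all_algebra.
From mathcomp Require Import all_classical all_reals all_analysis.
From mathcomp Require polyrcf.
From mathcomp Require Import measurable_realfun ring lra.
Set Implicit Arguments.
Unset Strict Implicit.
Unset Printing Implicit Defensive.
Import Order.TTheory GRing.Theory Num.Theory.
Import numFieldNormedType.Exports.
Local Open Scope classical_set_scope.
Local Open Scope ring_scope.

(** Fix [x] and write [v(y)] for [G y_1 + Sigma^(1/2) Phi^-1(y_2)], so that the
    integrand is [c * exp (psi_x y)] with [psi_x] equal to minus half the squared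
    [Sigma^-1]-norm of [v(y) - G x].  The estimate rests on three facts.

    - One derivative in [y_i] costs at most a constant times
      [1 / min(y_i, 1 - y_i)]: in the first block because the mixed derivatives
      of [G] are bounded, in the second because the derivative of [Phi^-1] is
      the inverse of the normal density at the quantile, which the Mills
      inequality compares with the tail probability ([inv_pdf_icdf_le]).  With
      [M(y)] the product of the [1 + |Phi^-1(y_i)|], every mixed derivative of
      [psi_x] is thus at most a constant times [M(y)^2] times the product of
      those weights, uniformly in [x] ([exponent_family_bounded]).

    - A mixed derivative of [exp psi_x] is [exp psi_x] times a polynomial in
      mixed derivatives of [psi_x].  So every mixed derivative of the integral
      is at most the integral itself times a power of [M(y)] and the weights
      ([evidence_family_bounded]).  The derivatives of the logarithm divide by
      powers of the integral, which cancel exactly, and only [ln] of the integral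
      remains; it is at most of order [M(y)^2] ([ln_evidence_le]).

    - Gaussian tails make any power of [|Phi^-1(y_i)|] smaller than a multiple of
      [min(y_i, 1 - y_i)^-A], for every [A > 0] ([quantile_size_growth]); this
      absorbs the power of [M(y)] that is left.

    Mixed partial derivatives are handled as functions of the set [u] of
    variables.  In this form the Leibniz rule is the convolution over subsets,
    and composition with [F] is evaluation of the Taylor series of [F] at the
    non-constant part, where powers are convolution powers ([conv_apply]).
    These formulas are symmetric in the variables, so they are valid for every
    order of differentiation at once, without any exchange of derivatives.
    Only [G] itself is evaluated at the integration variable, and its Lipschitz
    continuity gives the measurability that differentiation under the integral
    sign requires. *)

(** * Convolution of functions of finite sets *)

Section subset_convolution.
Context {R : realType} {I : finType}.
Implicit Types (a b : {set I} -> R) (u w : {set I}) (j : I).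

(** The product of the algebra of polynomials in variables of square zero, where
    [a] stands for the sum of the [a u] times the monomial of [u].  If [a] and
    [b] collect the mixed derivatives of two functions, this is the Leibniz rule
    for their product. *)
Definition subset_conv a b u : R :=
  \sum_(w : {set I} | w \subset u) a w * b (u :\: w).

Definition drop_set0 a u : R := if u == finset.set0 then 0 else a u.

Fixpoint conv_pow a (k : nat) u : R :=
  if k is k'.+1 then subset_conv (drop_set0 a) (conv_pow a k') u
  else (u == finset.set0)%:R.

(** The Taylor series, at the constant term of [a], of a function with
    derivatives [F k] there; it is finite because [drop_set0 a] is nilpotent.  If
    [a] collects the mixed derivatives of a function, this is the formula of Faa
    di Bruno for the composite. *)
Definition conv_apply (F : nat -> R) a u : R :=
  \sum_(k < #|I|.+1) F k / k`!%:R * conv_pow a k u.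

Lemma sum_subset_setU1 (F : {set I} -> R) j u : j \notin u ->
  \sum_(w : {set I} | w \subset j |: u) F w =
  \sum_(w : {set I} | w \subset u) F (j |: w) + \sum_(w : {set I} | w \subset u) F w.
Proof.
move=> ju; rewrite (bigID [pred w : {set I} | j \in w]) /=; congr (_ + _); last first.
  apply: eq_bigl => w; apply/andP/idP => [[wju jw]|wu].
    apply/fintype.subsetP => i iw; have := fintype.subsetP wju i iw.
    by rewrite !inE => /orP[/eqP ij|//]; rewrite -ij iw in jw.
  split; first exact: fintype.subset_trans wu (finset.subsetUr _ _).
  by apply: contra ju; exact: fintype.subsetP.
rewrite (reindex_onto (fun w => j |: w) (fun w => w :\ j)) /=; last first.
  by move=> w /andP[_ jw]; rewrite finset.setD1K.
apply: eq_bigl => w; rewrite !inE eqxx /= andbT.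
apply/andP/idP => [[wju /eqP wj]|wu].
  apply/fintype.subsetP => i iw; have := iw; rewrite -wj !inE => /andP[ij _].
  have : i \in j |: u by apply: (fintype.subsetP wju); rewrite !inE iw orbT.
  by rewrite !inE (negbTE ij).
split; first exact: finset.setUS.
rewrite finset.setU1K //; apply: contra ju; exact: fintype.subsetP.
Qed.

(** Adding a variable is a derivation: it goes to one of the two factors. *)
Lemma subset_conv_setU1 a b j u : j \notin u ->
  subset_conv a b (j |: u) =
  subset_conv (fun w => a (j |: w)) b u + subset_conv a (fun w => b (j |: w)) u.
Proof.
move=> ju; rewrite /subset_conv sum_subset_setU1//; congr (_ + _).
  apply: eq_bigr => w wu; congr (_ * b _); apply/setP => i; rewrite !inE.
  by case: eqVneq => // ->; rewrite (negbTE ju) andbF.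
apply: eq_bigr => w wu; congr (_ * b _); apply/setP => i; rewrite !inE.
case: eqVneq => // -> /=; rewrite andbT; apply: contra ju; exact: fintype.subsetP.
Qed.

Lemma subset_conv_set0 a b :
  subset_conv a b finset.set0 = a finset.set0 * b finset.set0.
Proof.
rewrite /subset_conv (eq_bigl (pred1 finset.set0)); last first.
  by move=> w; rewrite finset.subset0.
by rewrite big_pred1_eq finset.setD0.
Qed.

(** A set with fewer than [k] elements is not a union of [k] disjoint nonempty
    sets. *)
Lemma conv_pow_eq0 a k u : (#|u| < k)%N -> conv_pow a k u = 0.
Proof.
elim: k u => [//|k IH] u uk /=; rewrite /subset_conv big1// => w wu.
rewrite /drop_set0; case: eqVneq => [_|w0]; first by rewrite mul0r.
rewrite IH ?mulr0// (leq_trans _ (uk : #|u| <= k)%N)//.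
by rewrite -(finset.cardsID w u) (finset.setIidPr wu) -addn1 addnC leq_add2r card_gt0.
Qed.

Lemma conv_apply_set0 F a : conv_apply F a finset.set0 = F 0%N.
Proof.
rewrite /conv_apply big_ord_recl big1 => [|i _]; last first.
  by rewrite conv_pow_eq0 ?mulr0// finset.cards0.
by rewrite addr0 /= eqxx mulr1 fact0 divr1.
Qed.

End subset_convolution.

(** * Mixed derivatives of products and composites *)

Section mixed_derivative_rules.
Context {R : realType} (I : finType) (j : I) (x : R).
Implicit Types (a b : R -> {set I} -> R) (u w : {set I}).

(** The curve [a] takes values in the functions of sets; its derivative at [x] is
    the shift by the variable [j], wherever that shift makes sense.  This isolates
    from the notion of mixed partial derivatives what happens along one line. *)
Definition derives_along a : Prop :=
  forall u : {set I}, j \notin u -> is_derive x 1 (fun t => a t u) (a x (j |: u)).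

Lemma notin_setD (u w : {set I}) : j \notin u -> j \notin u :\: w.
Proof. by apply: contra; rewrite !inE => /andP[]. Qed.

Lemma notin_subset (u w : {set I}) : w \subset u -> j \notin u -> j \notin w.
Proof. by move=> wu; apply: contra; exact: fintype.subsetP. Qed.

Lemma is_derive_sumr (J : Type) (r : seq J) (P : pred J) (f : J -> R -> R) (df : J -> R) :
  (forall i, P i -> is_derive x 1 (f i) (df i)) ->
  is_derive x 1 (fun t => \sum_(i <- r | P i) f i t) (\sum_(i <- r | P i) df i).
Proof.
move=> fdf; elim: r => [|i r IH].
  by under eq_fun do rewrite big_nil; rewrite big_nil; exact: is_derive_cst.
under eq_fun do rewrite big_cons; rewrite big_cons.
by case: ifPn => Pi //; apply: is_deriveD => //; exact: fdf.
Qed.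

Lemma is_derive_mulr (f g : R -> R) (df dg : R) :
  is_derive x 1 f df -> is_derive x 1 g dg ->
  is_derive x 1 (fun t => f t * g t) (df * g x + f x * dg).
Proof.
move=> hf hg; have := is_deriveM hf hg.
move=> h; apply: (is_derive_eq h).
by rewrite /GRing.scale/=; ring.
Qed.

Lemma is_derive_subset_conv (a b : R -> {set I} -> R) (da db : {set I} -> R) u :
  j \notin u ->
  (forall w : {set I}, j \notin w -> is_derive x 1 (fun t => a t w) (da w)) ->
  (forall w : {set I}, j \notin w -> is_derive x 1 (fun t => b t w) (db w)) ->
  is_derive x 1 (fun t => subset_conv (a t) (b t) u)
    (subset_conv da (b x) u + subset_conv (a x) db u).
Proof.
move=> ju ha hb; rewrite /subset_conv -big_split /=.
apply: is_derive_sumr => w wu; apply: is_derive_mulr.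
  by apply: ha; exact: notin_subset ju.
by apply: hb; exact: notin_setD.
Qed.

Lemma subset_conv_derives a b : derives_along a -> derives_along b ->
  derives_along (fun t => subset_conv (a t) (b t)).
Proof.
move=> ha hb u ju; rewrite subset_conv_setU1//.
exact: is_derive_subset_conv.
Qed.

(** Among the decompositions of [j |: u] into [k] ordered nonempty parts, those
    where [j] joins a nonempty part come from differentiating that part; the
    correction counts the [k] places where [j] can be a part of its own. *)
Lemma is_derive_conv_pow a k u : derives_along a -> j \notin u ->
  is_derive x 1 (fun t => conv_pow (a t) k u)
    (conv_pow (a x) k (j |: u) - k%:R * a x [set j]%SET * conv_pow (a x) k.-1 u).
Proof.
move=> ha; elim: k u => [|k IH] u ju.
  rewrite /= !mul0r subr0 (_ : (j |: u == _) = false); first exact: is_derive_cst.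
  by apply/negbTE/set0Pn; exists j; rewrite !inE eqxx.
rewrite [conv_pow _ _.+1 (_ |: _)]/= subset_conv_setU1//.
(* At the empty set [drop_set0] is constantly zero instead of having [a x [set j]]
   as its derivative. *)
pose da w := drop_set0 (a x) (j |: w) - (w == finset.set0)%:R * a x [set j]%SET.
have hda (w : {set I}) : j \notin w -> is_derive x 1 (fun t => drop_set0 (a t) w) (da w).
  move=> jw; rewrite /da /drop_set0 (_ : (_ |: _ == _) = false); last first.
    by apply/negbTE/set0Pn; exists j; rewrite !inE eqxx.
  case: (eqVneq w finset.set0) => [->|w0].
    by rewrite finset.setU0 mul1r subrr; exact: is_derive_cst.
  by rewrite mul0r subr0; exact: ha.
have hconv := @is_derive_subset_conv (fun t => drop_set0 (a t))
  (fun t => conv_pow (a t) k) _ _ u ju hda IH.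
apply: (is_derive_eq hconv).
have -> : subset_conv da (conv_pow (a x) k) u =
    subset_conv (fun w => drop_set0 (a x) (j |: w)) (conv_pow (a x) k) u
    - a x [set j]%SET * conv_pow (a x) k u.
  rewrite /subset_conv/da; under eq_bigr do rewrite mulrBl.
  rewrite big_split /=; congr (_ + _); rewrite sumrN; congr (- _).
  rewrite (bigD1 finset.set0) ?finset.sub0set//= eqxx mul1r finset.setD0.
  by rewrite big1 ?addr0// => w /andP[_ /negbTE ->]; rewrite !mul0r.
have -> : subset_conv (drop_set0 (a x))
    (fun w => conv_pow (a x) k (j |: w) - k%:R * a x [set j]%SET * conv_pow (a x) k.-1 w) u =
    subset_conv (drop_set0 (a x)) (fun w => conv_pow (a x) k (j |: w)) u
    - k%:R * a x [set j]%SET * conv_pow (a x) k u.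
  rewrite /subset_conv; under eq_bigr do rewrite mulrBr.
  rewrite big_split /= sumrN; congr (_ - _).
  case: k {IH hconv} => [|k]; first by rewrite big1 ?mul0r// => w _; rewrite !mul0r mulr0.
  by rewrite /= /subset_conv mulr_sumr; apply: eq_bigr => w _; ring.
rewrite -natr1; ring.
Qed.

(** The derivative of [F k], through the chain rule, cancels against the
    correction term of the power [k.+1], so the sum telescopes. *)
Lemma conv_apply_derives (F : nat -> R -> R) a : derives_along a ->
  (forall k, is_derive (a x finset.set0) 1 (F k) (F k.+1 (a x finset.set0))) ->
  derives_along (fun t => conv_apply (F ^~ (a t finset.set0)) (a t)).
Proof.
move=> ha hF u ju.
set h := a x finset.set0; set hj := a x [set j]%SET.
have hh : is_derive x 1 (fun t => a t finset.set0) hj.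
  by rewrite /hj -[[set j]%SET]finset.setU0; apply: ha; rewrite inE.
rewrite /conv_apply.
have hk (k : nat) : is_derive x 1 (fun t => F k (a t finset.set0) / k`!%:R * conv_pow (a t) k u)
    (F k h / k`!%:R * conv_pow (a x) k (j |: u) +
    (F k.+1 h * hj / k`!%:R * conv_pow (a x) k u
     - k%:R * (F k h * hj / k`!%:R * conv_pow (a x) k.-1 u))).
  have h1 := is_derive_mulr (@is_derive1_comp R (F k) (fun t => a t finset.set0) x _ _ (hF k) hh)
     (is_derive_cst (k`!%:R^-1 : R) x (1 : R)).
  apply: (is_derive_eq (is_derive_mulr h1 (is_derive_conv_pow k ha ju))).
  by rewrite /= -/h -/hj; ring.
apply: (is_derive_eq (is_derive_sumr (index_enum _) (fun (k : 'I_(#|I|.+1)) (_ : true) => hk k))).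
rewrite big_split /= -[RHS]addr0; congr (_ + _).
pose T k := F k.+1 h * hj / k`!%:R * conv_pow (a x) k u.
rewrite (eq_bigr (fun k : 'I_(#|I|.+1) => T k - (if (k : nat) is m.+1 then T m else 0))).
  rewrite -(big_mkord xpredT (fun k => T k - (if k is m.+1 then T m else 0))).
  rewrite big_nat_recl// subr0.
  rewrite (telescope_sumr_eq (fun k => T k))// addrCA subrr addr0 /T.
  (* The last term vanishes: [u] misses [j], so it has fewer than [#|I|] elements. *)
rewrite conv_pow_eq0 ?mulr0//; apply: proper_card; apply/properP; split; last by exists j.
  exact/fintype.subsetP.
move=> [[|k] kn] _ /=; first by rewrite mul0r.
rewrite /T; congr (_ - _); rewrite factS natrM.
field; by rewrite -(natrD R 1) !pnatr_eq0 -lt0n fact_gt0.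
Qed.

End mixed_derivative_rules.

(** * Bounds by products of weights *)

Section weighted_bounds.
Context {R : realType} (I : finType) (w : I -> R).
Hypothesis w_ge1 : forall i, 1 <= w i.
Implicit Types (a b : {set I} -> R) (u v : {set I}) (A B : R).

Local Notation W u := (\prod_(i in u) w i).

Definition weight_bounded a A : Prop := forall u, `|a u| <= A * W u.

Lemma weight_ge1 u : 1 <= W u.
Proof. by elim/big_ind : _ => // x y x1 y1; rewrite -[leLHS]mulr1 ler_pM. Qed.

Lemma weight_ge0 u : 0 <= W u.
Proof. exact: le_trans (weight_ge1 u). Qed.

Lemma weight_set0 : W finset.set0 = 1.
Proof. by rewrite big1// => i; rewrite inE. Qed.

Lemma weight_setD u v : v \subset u -> W v * W (u :\: v) = W u.
Proof.
move=> vu; rewrite [RHS](bigID [in v]) /=; congr (_ * _); apply: eq_bigl => i.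
  by rewrite andb_idl// => /(fintype.subsetP vu).
by rewrite inE andbC.
Qed.

Lemma weight_bounded_cst a A : (forall u, `|a u| <= A) -> weight_bounded a A.
Proof.
move=> aA u; apply: (le_trans (aA u)); rewrite ler_peMr ?weight_ge1//.
exact: le_trans (aA u).
Qed.

Lemma weight_bounded_le a A B : A <= B -> weight_bounded a A -> weight_bounded a B.
Proof. by move=> AB h u; rewrite (le_trans (h u))// ler_wpM2r// weight_ge0. Qed.

Lemma weight_boundedD a b A B : weight_bounded a A -> weight_bounded b B ->
  weight_bounded (fun u => a u + b u) (A + B).
Proof.
by move=> ha hb u; rewrite mulrDl (le_trans (ler_normD _ _))// lerD.
Qed.

Lemma weight_boundedB a b A B : weight_bounded a A -> weight_bounded b B ->
  weight_bounded (fun u => a u - b u) (A + B).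
Proof.
by move=> ha hb u; rewrite mulrDl (le_trans (ler_normB _ _))// lerD.
Qed.

Lemma weight_bounded_comb (J : finType) (c : J -> R) (a : J -> {set I} -> R) A :
  (forall k, weight_bounded (a k) A) ->
  weight_bounded (fun u => \sum_k c k * a k u) ((\sum_k `|c k|) * A).
Proof.
move=> ha u; apply: (le_trans (ler_norm_sum _ _ _)).
rewrite -mulrA mulr_suml; apply: ler_sum => k _.
by rewrite normrM ler_wpM2l//; exact: ha.
Qed.

Lemma card_subset_le u : (#|[pred v : {set I} | v \subset u]| <= 2 ^ #|I|)%N.
Proof.
apply: (leq_trans (max_card _)).
by rewrite -cardsT -powersetT card_powerset cardsT.
Qed.

(** The weight of [u] factors as the weight of [v] times that of its complement
    in [u], so each of the at most [2 ^ #|I|] terms of the convolution obeys the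
    same bound. *)
Lemma weight_bounded_conv a b A B : 0 <= A -> 0 <= B ->
  weight_bounded a A -> weight_bounded b B ->
  weight_bounded (subset_conv a b) (2 ^+ #|I| * A * B).
Proof.
move=> A0 B0 ha hb u; apply: (le_trans (ler_norm_sum _ _ _)).
apply: (@le_trans _ _ (\sum_(v : {set I} | v \subset u) A * B * W u)).
  apply: ler_sum => v vu; rewrite normrM -(weight_setD vu) mulrACA.
  exact: ler_pM.
rewrite sumr_const -[leLHS]mulr_natl -!mulrA ler_wpM2r ?mulr_ge0 ?weight_ge0//.
by rewrite -natrX ler_nat card_subset_le.
Qed.

Lemma weight_bounded_conv_pow a A k : 0 <= A -> weight_bounded a A ->
  weight_bounded (conv_pow a k) ((2 ^+ #|I| * A) ^+ k).
Proof.
move=> A0 ha; have A0' : 0 <= 2 ^+ #|I| * A by rewrite mulr_ge0// exprn_ge0.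
elim: k => [|k IH].
  move=> u; rewrite expr0 mul1r /=; case: eqVneq => [->|_].
    by rewrite weight_set0 normr1.
  by rewrite normr0 weight_ge0.
rewrite exprS; apply: weight_bounded_conv => //; first exact: exprn_ge0.
move=> v; rewrite /drop_set0; case: eqP => _; last exact: ha.
by rewrite normr0 mulr_ge0// weight_ge0.
Qed.

(** The scale [s] is there for the logarithm: its [k]-th derivative at [s] is of
    order [s ^- k], while all derivatives of the inner function carry a factor
    [s]; the two cancel, and the bound does not depend on [s]. *)
Lemma weight_bounded_conv_apply (F : nat -> R) a (s B C : R) :
  0 <= s -> 1 <= B -> weight_bounded a (s * B) ->
  (forall k, (k <= #|I|)%N -> `|F k| * s ^+ k <= C) ->
  weight_bounded (conv_apply F a) (#|I|.+1%:R * C * (2 ^+ #|I| * B) ^+ #|I|).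
Proof.
move=> s0 B1 ha hF u; have B0 : 0 <= B by exact: le_trans B1.
have C0 : 0 <= C by apply: le_trans (hF 0%N isT); rewrite mulr_ge0// exprn_ge0.
have q1 : 1 <= 2 ^+ #|I| * B.
  by rewrite -[leLHS]mulr1 ler_pM// -natrX ler1n expn_gt0.
apply: (le_trans (ler_norm_sum _ _ _)).
apply: (@le_trans _ _ (\sum_(k < #|I|.+1) C * (2 ^+ #|I| * B) ^+ #|I| * W u)); last first.
  by rewrite sumr_const card_ord -[leLHS]mulr_natl !mulrA.
apply: ler_sum => k _; rewrite normrM.
apply: (@le_trans _ _ (`|F k| * ((2 ^+ #|I| * (s * B)) ^+ k * W u))).
  apply: ler_pM => //; last by apply: weight_bounded_conv_pow => //; rewrite mulr_ge0.
  rewrite normrM ler_piMr// ger0_norm ?invr_ge0 ?ler0n// invf_le1 ?ltr0n ?fact_gt0//.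
  by rewrite ler1n fact_gt0.
have kI : (k <= #|I|)%N by rewrite -ltnS.
have -> : `|F k| * ((2 ^+ #|I| * (s * B)) ^+ k * W u) =
    `|F k| * s ^+ k * (2 ^+ #|I| * B) ^+ k * W u by rewrite !exprMn; ring.
rewrite ler_wpM2r ?weight_ge0// ler_pM ?mulr_ge0 ?exprn_ge0 ?mulr_ge0//.
  exact: hF.
by rewrite ler_weXn2l.
Qed.

End weighted_bounds.

(** * The standard normal quantile function *)

Section normal_quantile.
Context {R : realType}.
Implicit Types (t x : R).

Local Notation phi := (@normal_pdf R 0 1).
Local Notation Phi := (@std_normal_cdf R).
Local Notation icdf := (@std_normal_icdf R).

Lemma std_normal_pdfE x : phi x = normal_peak 1 * expR (- (x ^+ 2 / 2)).
Proof. by rewrite normal_pdfE ?oner_neq0//= /normal_fun subr0 expr1n mulNr. Qed.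

Lemma std_normal_pdf_gt0 x : 0 < phi x.
Proof. by rewrite std_normal_pdfE mulr_gt0 ?expR_gt0// normal_peak_gt0 ?oner_neq0. Qed.

Lemma is_derive_std_normal_cdf x : is_derive x 1 Phi (phi x).
Proof.
have [] := @continuous_FTC1 R phi -oo%O x (x + 1).
- by rewrite ltrDl.
- by apply: (integrableS _ _ (subsetT _)) => //; exact: integrable_normal_pdf.
- by rewrite ltNyr.
- by apply: continuous_normal_pdf; rewrite oner_neq0.
by move=> dPhi Phi'; apply: (DeriveDef dPhi); rewrite -derive1E; exact: Phi'.
Qed.

Lemma is_derive_std_normal_pdf x : is_derive x 1 phi (- x * phi x).
Proof.
have -> : phi = (fun t => normal_peak 1 * expR (- (t ^+ 2 / 2))).
  by apply/funext => t; rewrite std_normal_pdfE.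
have hq : is_derive x 1 (fun t : R => - (t ^+ 2 / 2)) (- x).
  have -> : (fun t : R => - (t ^+ 2 / 2)) = (- 2^-1) \*: ((@idfun R) ^+ 2).
    by apply/funext => t; rewrite /= /GRing.scale/= mulNr [in RHS]mulrC.
  apply: is_derive_eq; rewrite /= /GRing.scale/= expr1 mulr1.
  by field.
have he := @is_derive1_comp R expR _ x _ _ (is_derive_expR _) hq.
have hc := is_derive_mulr (is_derive_cst (normal_peak 1 : R) x (1 : R)) he.
apply: (is_derive_eq hc).
by rewrite /= /cst; ring.
Qed.

Lemma is_derive_mono (f df : R -> R) (a b : R) :
  (forall x, is_derive x 1 f (df x)) -> a <= b ->
  (forall x, a <= x <= b -> 0 <= df x) -> f a <= f b.
Proof.
move=> fdf ab df0; rewrite -subr_ge0.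
have [|c /[!in_itv]/= cab ->] := MVT_segment ab (fun x _ => fdf x).
  apply: continuous_subspaceT => z.
  by apply/differentiable_continuous/derivable1_diffP; case: (fdf z).
by rewrite mulr_ge0 ?subr_ge0// df0.
Qed.

Lemma std_normal_cdf_lt x y : x < y -> Phi x < Phi y.
Proof.
move=> xy; rewrite -subr_gt0.
have [|c _ ->] := MVT xy (fun x _ => is_derive_std_normal_cdf x).
  apply: continuous_subspaceT => z.
  apply/differentiable_continuous/derivable1_diffP.
  by case: (is_derive_std_normal_cdf z).
by rewrite mulr_gt0 ?subr_gt0// std_normal_pdf_gt0.
Qed.

Lemma continuous_std_normal_cdf : continuous Phi.
Proof.
move=> z; apply/differentiable_continuous/derivable1_diffP.
by case: (is_derive_std_normal_cdf z).
Qed.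

(* The limits at infinity of the distribution function are those of the
   cumulative distribution function of the identity random variable. *)
Let idT : measurableTypeR R -> R := idfun.

#[local] HB.instance Definition _ :=
  @isMeasurableFun.Build _ _ _ _ idT (@measurable_id _ _ setT).

Let fin_cdf x : normal_prob 0 1 `]-oo, x] \is a fin_num.
Proof. exact: fin_num_measure. Qed.

Lemma std_normal_cdf_gtP t : t < 1 -> exists x, t < Phi x.
Proof.
move=> t1.
have /fine_cvgP[_] := @cvg_cdfy1 _ _ R (@normal_prob R 0 1) idT.
move=> /cvgr_gt /(_ _ t1) [M [_ hM]].
by exists (M + 1); apply: hM; rewrite ltrDl.
Qed.

Lemma std_normal_cdf_ltP t : 0 < t -> exists x, Phi x < t.
Proof.
move=> t0.
have /fine_cvgP[_] := @cvg_cdfNy0 _ _ R (@normal_prob R 0 1) idT.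
move=> /cvgr_lt /(_ _ t0) [M [_ hM]].
by exists (M - 1); apply: hM; rewrite gtrBl.
Qed.

Lemma std_normal_cdfK : cancel Phi icdf.
Proof.
move=> x; rewrite /std_normal_icdf pinvKV ?inE// => y z _ _ yz.
by apply/eqP; case: (ltgtP y z) => // /std_normal_cdf_lt; rewrite yz ltxx.
Qed.

Lemma std_normal_icdfK t : 0 < t < 1 -> Phi (icdf t) = t.
Proof.
move=> /andP[t0 t1].
have [a at_] := std_normal_cdf_ltP t0.
have [b tb] := std_normal_cdf_gtP t1.
have ab : a <= b.
  by rewrite leNgt; apply/negP => /std_normal_cdf_lt; lra.
have [||c _ <-] := @IVT R Phi a b t ab; last by rewrite std_normal_cdfK.
- exact/continuous_subspaceT/continuous_std_normal_cdf.
- by rewrite ge_min le_max (ltW at_) (ltW tb) orbT.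
Qed.

Lemma is_derive_std_normal_icdf t : 0 < t < 1 ->
  is_derive t 1 icdf (phi (icdf t))^-1.
Proof.
move=> t01; rewrite -{1}(std_normal_icdfK t01).
apply: (@is_derive_inverse R Phi icdf).
- by apply: filterE => z; exact: std_normal_cdfK.
- by apply: filterE => z; exact: continuous_std_normal_cdf.
- exact: is_derive_std_normal_cdf.
- by rewrite gt_eqF// std_normal_pdf_gt0.
Qed.

(** [Phi + phi] is nonincreasing on [1, oo[, since its derivative is
    [(1 - x) phi x], and tends to [1]. *)
Lemma mills_upper x : 1 <= x -> 1 - Phi x <= phi x.
Proof.
move=> x1; rewrite leNgt; apply/negP => h.
have [y hy] : exists y, phi x + Phi x < Phi y by apply: std_normal_cdf_gtP; lra.
have px := std_normal_pdf_gt0 x.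
have xy : x <= y by rewrite leNgt; apply/negP => /std_normal_cdf_lt; lra.
have hd (z : R) : is_derive z 1 (- (Phi + phi)) (- (phi z + - z * phi z)).
  apply: is_deriveN; apply: is_deriveD.
    exact: is_derive_std_normal_cdf.
  exact: is_derive_std_normal_pdf.
have := is_derive_mono hd xy; rewrite !fctE => H.
have {H} : - (Phi x + phi x) <= - (Phi y + phi y).
  apply: H => z /andP[xz _]; have pz := std_normal_pdf_gt0 z.
  by rewrite -[X in X + _]mul1r -mulrDl -mulNr mulr_ge0 ?(ltW pz)//; lra.
by have := std_normal_pdf_gt0 y; lra.
Qed.

(** [phi - Phi] is nondecreasing on ]-oo, -1], since its derivative is
    [(- x - 1) phi x], and tends to [0] at minus infinity. *)
Lemma mills_lower x : x <= -1 -> Phi x <= phi x.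
Proof.
move=> x1; rewrite leNgt; apply/negP => h.
have [y hy] : exists y, Phi y < Phi x - phi x by apply: std_normal_cdf_ltP; lra.
have px := std_normal_pdf_gt0 x.
have yx : y <= x by rewrite leNgt; apply/negP => /std_normal_cdf_lt; lra.
have hd (z : R) : is_derive z 1 (phi - Phi) (- z * phi z - phi z).
  apply: is_deriveB.
    exact: is_derive_std_normal_pdf.
  exact: is_derive_std_normal_cdf.
have := is_derive_mono hd yx; rewrite !fctE => H.
have {H} : phi y - Phi y <= phi x - Phi x.
  apply: H => z /andP[_ zx]; have pz := std_normal_pdf_gt0 z.
  by rewrite -[X in _ - X]mul1r -mulrBl mulr_ge0 ?(ltW pz)//; lra.
by have := std_normal_pdf_gt0 y; lra.
Qed.

Lemma std_normal_tail_le_pdf :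
  exists2 C : R, 0 < C & forall x, Num.min (Phi x) (1 - Phi x) <= C * phi x.
Proof.
have p1 := std_normal_pdf_gt0 1.
have p1V : 0 < (phi 1)^-1 by rewrite invr_gt0.
(* On [-1, 1] the left-hand side is at most 1 and [phi] is at least [phi 1]. *)
exists (1 + (phi 1)^-1) => [|x]; first by lra.
have px := std_normal_pdf_gt0 x.
have le_phi : phi x <= (1 + (phi 1)^-1) * phi x by rewrite ler_peMl ?(ltW px)//; lra.
rewrite ge_min; have [x1|x1] := leP 1 x.
  by rewrite (le_trans (mills_upper x1) le_phi) orbT.
have [x2|x2] := leP x (-1); first by rewrite (le_trans (mills_lower x2) le_phi).
have -> : Phi x <= (1 + (phi 1)^-1) * phi x => //.
apply: (@le_trans _ _ 1).
  by rewrite -lee_fin /std_normal_cdf fineK ?fin_cdf//; exact: probability_le1.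
have p1x : phi 1 <= phi x.
  rewrite !std_normal_pdfE ler_wpM2l ?normal_peak_ge0// ler_expR lerN2.
  by rewrite ler_wpM2r ?invr_ge0//; nra.
rewrite mulrDl mul1r ler_wpDl ?(ltW px)//.
by rewrite ler_pdivlMl// mulr1.
Qed.

(** The left-hand side is the derivative of the quantile function. *)
Lemma inv_pdf_icdf_le :
  exists2 C : R, 0 < C &
    forall t, 0 < t < 1 -> (phi (icdf t))^-1 <= C * (Num.min t (1 - t))^-1.
Proof.
have [C C0 hC] := std_normal_tail_le_pdf.
exists C => // t t01; have p := std_normal_pdf_gt0 (icdf t).
have m0 : 0 < Num.min t (1 - t) by rewrite lt_min; lra.
have := hC (icdf t); rewrite std_normal_icdfK// => h.
by rewrite ler_pdivlMr// mulrC ler_pdivrMr.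
Qed.

Lemma poly_le_gauss (c : R) (N : nat) : 0 < c ->
  exists2 K : R, 0 < K & forall x, (1 + `|x|) ^+ N <= K * expR (N%:R * c * x ^+ 2).
Proof.
move=> c0; have cV : 0 < c^-1 by rewrite invr_gt0.
exists ((2 + c^-1) ^+ N) => [|x]; first by rewrite exprn_gt0//; lra.
rewrite -mulrA expRM_natl -exprMn lerXn2r ?nnegrE//.
- by rewrite mulr_ge0 ?expR_ge0//; lra.
apply: (@le_trans _ _ ((2 + c^-1) * (1 + c * x ^+ 2))); last first.
  by rewrite ler_wpM2l ?expR_ge1Dx//; lra.
rewrite mulrDr mulr1 mulrDl mulKf ?gt_eqF//.
have : 0 <= c * x ^+ 2 by rewrite mulr_ge0 ?sqr_ge0 ?ltW.
rewrite -[in X in _ + (_ + X)]real_normK ?num_real//.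
have := normr_ge0 x; nra.
Qed.

(** With [x] the quantile of [t], the tail bound gives that [min t (1 - t)] is at
    most a multiple of [exp (- x^2 / 2)], so its power [- A] grows at least like
    [exp (A x^2 / 2)], which dominates every power of [|x|]. *)
Lemma icdf_growth (A : R) (N : nat) : 0 < A ->
  exists2 K : R, 0 < K & forall t, 0 < t < 1 ->
    (1 + `|icdf t|) ^+ N <= K * Num.min t (1 - t) `^ (- A).
Proof.
move=> A0; have [C C0 hC] := std_normal_tail_le_pdf.
(* Chosen so that [N.+1 * c = A / 2]; the exponent [N.+1] avoids dividing by 0. *)
pose c := A / (2 * N.+1%:R).
have c0 : 0 < c by rewrite divr_gt0// mulr_gt0.
have [K K0 hK] := poly_le_gauss N.+1 c0.
pose p : R := C * normal_peak 1.
have p0 : 0 < p by rewrite mulr_gt0// normal_peak_gt0 ?oner_neq0.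
exists (K * p `^ A) => [|t t01]; first by rewrite mulr_gt0// powR_gt0.
set x := icdf t; have m0 : 0 < Num.min t (1 - t) by rewrite lt_min; lra.
apply: (@le_trans _ _ ((1 + `|x|) ^+ N.+1)).
  by rewrite ler_weXn2l// lerDl.
apply: (le_trans (hK x)); rewrite -[leRHS]mulrA ler_pM2l//.
have -> : N.+1%:R * c * x ^+ 2 = A * (x ^+ 2 / 2).
  by rewrite /c; field; rewrite -(natrD R 1) pnatr_eq0.
have hm : Num.min t (1 - t) <= p * expR (- (x ^+ 2 / 2)).
  have := hC x; rewrite std_normal_icdfK// std_normal_pdfE.
  by rewrite mulrA.
have q0 : 0 < p * expR (- (x ^+ 2 / 2)) by rewrite mulr_gt0 ?expR_gt0.
rewrite powRN ler_pdivlMr ?powR_gt0//.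
have := ge0_ler_powR (ltW A0) (ltW m0) (ltW q0) hm.
rewrite powRM ?expR_ge0 ?(ltW p0)// => h.
rewrite mulrC; apply: (le_trans (ler_wpM2r (expR_ge0 _) h)).
by rewrite -mulrA -expRM -expRD [X in expR X](_ : _ = 0) ?expR0 ?mulr1//; ring.
Qed.

End normal_quantile.

(** * Families of mixed partial derivatives *)

Section smooth_families.
Context {R : realType} (n : nat).
Implicit Types (E : set 'cV[R]_n) (D : {set 'I_n} -> 'cV[R]_n -> R).

(** [D] is closed under partial differentiation in the variables that are not yet
    used.  On an open set this says that [D] gives the mixed partial derivatives
    of [D set0]. *)
Definition partial_family E D : Prop :=
  forall (j : 'I_n) (z : 'cV[R]_n), E z ->
    derives_along j 0 (fun t w => D w (z + t *: delta_mx j 0)).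

Lemma derives_along_translate E D (j : 'I_n) (z : 'cV[R]_n) t :
  partial_family E D -> E (z + t *: delta_mx j 0) ->
  derives_along j t (fun s w => D w (z + s *: delta_mx j 0)).
Proof.
move=> ED Ez u ju; have := ED j _ Ez u ju; rewrite scale0r addr0 => h.
have ht : is_derive t 1 (fun s : R => s - t) (1 - 0).
  exact: is_deriveB.
have h' : is_derive (t - t) 1
    (fun s : R => D u (z + t *: delta_mx j 0 + s *: delta_mx j 0))
    (D (j |: u) (z + t *: delta_mx j 0)) by rewrite subrr.
have := @is_derive1_comp R _ (fun s => s - t) t _ _ h' ht.
rewrite subr0 mulr1; congr (is_derive _ _ _ _).
by apply/funext => s /=; rewrite -addrA -scalerDl (addrC t) subrK.
Qed.

Lemma is_derive_cvg (f : R -> R) (l : R) :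
  h^-1 *: (f h - f 0) @[h --> 0^'] --> l -> is_derive (0 : R) 1 f l.
Proof.
move=> fl; have fl' : h^-1 *: ((f \o shift 0) (h *: 1) - f 0) @[h --> 0^'] --> l.
  by under eq_fun do rewrite /= [_ *: 1]mulr1 addr0.
apply: DeriveDef; first by apply/cvg_ex; exists l.
exact/cvg_lim.
Qed.

Lemma cvg_is_derive (f : R -> R) (l : R) :
  is_derive (0 : R) 1 f l -> h^-1 *: (f h - f 0) @[h --> 0^'] --> l.
Proof.
move=> [/cvg_ex[k fk] <-]; rewrite /derive (cvg_lim _ fk)//.
by move: fk; under eq_fun do rewrite /= [_ *: 1]mulr1 addr0.
Qed.

Lemma partial_family_mixed_partials E D (F : 'cV[R]_n -> R^o) :
  partial_family E D -> (forall z, E z -> D finset.set0 z = F z) ->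
  mixed_partials E F (D : _ -> _ -> R^o).
Proof.
move=> ED DF; split => // u j z ju Ez; apply: cvg_within_filter.
by have := cvg_is_derive (ED j z Ez u ju); rewrite scale0r addr0.
Qed.

(** One-sided derivatives on the faces of [E] do not matter in [E'], from each point
    of which one can move in both directions inside [E]. *)
Lemma mixed_partials_coord m (F : 'cV[R]_n -> 'cV[R]_m) DF E E' (i : 'I_m) :
  mixed_partials E F DF ->
  (forall z, E' z -> E z) ->
  (forall z j, E' z -> \forall h \near (0 : R), E (z + h *: delta_mx j 0)) ->
  partial_family E' (fun u z => DF u z i 0).
Proof.
move=> [_ hDF] E'E nE j z E'z u ju.
have hl := hDF u j z ju (E'E z E'z); rewrite scale0r addr0.
apply: (@is_derive_cvg (fun t => DF u (z + t *: delta_mx j 0) i 0)).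
rewrite scale0r addr0.
have -> : (fun h : R => h^-1 *: (DF u (z + h *: delta_mx j 0) i 0 - DF u z i 0)) =
    (fun M : 'cV[R]_m => M i 0) \o
    (fun h : R => h^-1 *: (DF u (z + h *: delta_mx j 0) - DF u z)).
  by apply/funext => h /=; rewrite !mxE.
apply: (cvg_comp _ _ _ (@coord_continuous _ _ _ i 0 (DF (j |: u) z))).
have nE0 := nbhs_dnbhs (nE z j E'z).
move=> A /hl hA.
have {}hA : \forall h \near (0 : R)^', E (z + h *: delta_mx j 0) ->
    A ((h^-1 *: (DF u (z + h *: delta_mx j 0) - DF u z)) i 0) := hA.
by apply: filterS2 nE0 hA => h Eh; apply.
Qed.

End smooth_families.

(** * Differentiation under the integral sign *)

Section integral_families.
Context {R : realType} (n : nat) d (Y : measurableType d)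
  (mu : {measure set Y -> \bar R}) (B : set Y).
Hypotheses (mB : measurable B) (muB : (mu B < +oo)%E).

Lemma bounded_integrable (f : Y -> R) (C : R) :
  measurable_fun B f -> (forall y, B y -> `|f y| <= C) ->
  mu.-integrable B (EFin \o f).
Proof.
move=> mf fC; apply: measurable_bounded_integrable => //.
by exists C; split; rewrite ?num_real// => x Cx y By; exact: le_trans (fC y By) (ltW Cx).
Qed.

(** Local boundedness along lines is what domination needs: the measure being
    finite, the local bound of the next derivative is an integrable majorant. *)
Lemma partial_family_integral (E : set 'cV[R]_n)
    (D : Y -> {set 'I_n} -> 'cV[R]_n -> R) :
  (forall y, B y -> partial_family E (D y)) ->
  (forall u z, E z -> measurable_fun B (fun y => D y u z)) ->
  (forall u j z, E z -> exists2 e : R, 0 < e & exists C, forall t, `|t| < e ->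
     E (z + t *: delta_mx j 0) /\
     forall y, B y -> `|D y u (z + t *: delta_mx j 0)| <= C) ->
  partial_family E (fun u z => \int[mu]_(y in B) D y u z).
Proof.
move=> ED mD bD j z Ez u ju.
have [e e0 [C hC]] := bD u j z Ez.
have [e' e'0 [C' hC']] := bD (j |: u)%SET j z Ez.
pose r := Num.min e e'.
have I0 : `]- r, r[%classic (0 : R).
  by rewrite /= in_itv/= oppr_lt0 andbb lt_min e0.
have Ie t : `]- r, r[%classic t -> `|t| < e /\ `|t| < e'.
  by rewrite /= in_itv/= -ltr_norml lt_min => /andP.
pose f t y := D y u (z + t *: delta_mx j 0).
have intf t : `]- r, r[%classic t -> mu.-integrable B (EFin \o f t).
  move=> /Ie[te _]; have [Et Ct] := hC t te.
  by apply: (@bounded_integrable _ C) => //; exact: mD.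
have df t y : `]- r, r[%classic t -> B y ->
    is_derive t 1 (f ^~ y) (D y (j |: u)%SET (z + t *: delta_mx j 0)).
  move=> /Ie[te _] By; have [Et _] := hC t te.
  exact: (derives_along_translate (ED y By) Et).
have derf t y : `]- r, r[%classic t -> B y -> derivable (f ^~ y) t 1.
  by move=> It By; have [] := df t y It By.
have dfE t y : `]- r, r[%classic t -> B y ->
    partial1of2 f t y = D y (j |: u)%SET (z + t *: delta_mx j 0).
  by move=> It By; rewrite partial1of2E; have [] := df t y It By.
have intC : mu.-integrable B (EFin \o cst `|C'|).
  by apply: (@bounded_integrable _ `|C'|) => // y _; rewrite normr_id.
have bdf t y : `]- r, r[%classic t -> B y -> `|partial1of2 f t y| <= cst `|C'| y.
  move=> It By; rewrite dfE//; have [_ te] := Ie t It.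
  by rewrite (le_trans ((hC' t te).2 y By))// ler_norm.
have := cvg_differentiation_under_integral mB I0 intf derf
  (fun y => normr_ge0 C') intC bdf.
under eq_fun do rewrite addr0.
have -> : \int[mu]_(y in B) partial1of2 f 0 y =
    \int[mu]_(y in B) D y (j |: u)%SET (z + 0 *: delta_mx j 0).
  by apply: eq_Rintegral => y /set_mem By; rewrite dfE.
by move=> h; apply: is_derive_cvg.
Qed.

End integral_families.

(** * Lebesgue measure and measurable functions on the cube *)

Section cube_measurability.
Context {R : realType} (n : nat).

Local Notation mcube := ((@cV_of_tuple R n) @^-1` @closed_cube R n).

Lemma measurable_cube :
  measurable (mcube : set (n.-tuple (measurableTypeR R))).
Proof.
have := @measurable_box _ (measurableTypeR R) n (fun=> `[0, 1]%classic) (fun=> measurable_itv _).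
congr measurable; apply/seteqP; split=> t /= h i.
  by have := h i; rewrite in_itv/= mxE.
by have := h i; rewrite mxE in_itv.
Qed.

Lemma lebesgue_tuple_cube : lebesgue_tuple R n mcube = 1%E.
Proof.
have -> : mcube = [set t : n.-tuple (measurableTypeR R) |
    forall i, `[0%R, 1%R]%classic (tnth t i)].
  apply/seteqP; split=> t /= h i.
    by have := h i; rewrite mxE in_itv.
  by have := h i; rewrite in_itv/= mxE.
rewrite (lebesgue_tuple_box (fun=> measurable_itv _)) big1// => i _.
by rewrite lebesgue_measure_itv/= lte01 oppr0 adde0.
Qed.

Lemma l2norm_le (v : 'cV[R]_n) (e : R) : 0 <= e ->
  (forall i, `|v i 0| <= e) -> l2norm v <= n%:R * e.
Proof.
move=> e0 ve; rewrite /l2norm -[leRHS]ger0_norm ?mulr_ge0// -sqrtr_sqr.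
apply: ler_wsqrtr; apply: (@le_trans _ _ (\sum_(i < n) e ^+ 2)).
  by apply: ler_sum => i _; rewrite -[v i 0 ^+ 2]real_normK ?num_real// lerXn2r ?nnegrE.
rewrite sumr_const card_ord -[leLHS]mulr_natl exprMn ler_wpM2r ?sqr_ge0//.
by rewrite -natrX ler_nat -{1}[n]expn1; case: n => // m; rewrite leq_pexp2l.
Qed.

(** The sigma-algebra on tuples is generated by boxes, not by open sets, so the
    function is exhibited as the limit of step functions on grids of boxes. *)
Lemma measurable_cube_lipschitz (f : 'cV[R]_n -> R) (L : R) : 0 <= L ->
  (forall z z', closed_cube z -> closed_cube z' ->
     `|f z - f z'| <= L * l2norm (z - z')) ->
  measurable_fun (mcube : set (n.-tuple (measurableTypeR R)))
    (f \o (@cV_of_tuple R n)).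
Proof.
move=> L0 fL.
(* The lower corner of the cell [p] of the grid of mesh [1 / k.+1].  Cells are
   half-open, so the coordinate 1 needs the extra index [k.+1]. *)
pose g (k : nat) (p : {ffun 'I_n -> 'I_k.+2}) : 'cV[R]_n :=
  \col_i ((p i)%:R / k.+1%:R).
pose box (k : nat) (p : {ffun 'I_n -> 'I_k.+2}) : set (n.-tuple (measurableTypeR R)) :=
  [set t | forall i, `[(p i)%:R / k.+1%:R, (p i).+1%:R / k.+1%:R[%classic (tnth t i)].
pose h (k : nat) (t : n.-tuple (measurableTypeR R)) : R :=
  \sum_(p : {ffun 'I_n -> 'I_k.+2}) f (g k p) * \1_(box k p) t.
apply: (@measurable_fun_cvg _ _ _ _ h).
  move=> k; apply: measurable_sum => p; apply: measurable_funM => //.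
  apply: measurable_indic.
  exact: (@measurable_box _ (measurableTypeR R) n
    (fun i => `[(p i)%:R / k.+1%:R, (p i).+1%:R / k.+1%:R[%classic)
    (fun=> measurable_itv _)).
move=> t tB; pose v : 'cV[R]_n := cV_of_tuple t.
have v01 i : 0 <= tnth t i <= 1 by have := tB i; rewrite mxE.
suff hk k : `|h k t - f v| <= L * n%:R * k.+1%:R^-1.
  apply/(@cvgrPdist_le R R^o) => e e0.
  have : L * n%:R * k.+1%:R^-1 @[k --> \oo] --> L * n%:R * 0.
    by apply: cvgMr; exact: cvg_harmonic.
  rewrite mulr0 => /cvgr0_norm_le /(_ _ e0); apply: filterS => k.
  by rewrite distrC => /(le_trans (ler_norm _)); exact: le_trans.
have k0 : 0 < k.+1%:R :> R by [].
have lt_idx i : (Num.truncn (tnth t i * k.+1%:R) < k.+2)%N.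
  have /andP[t0 t1] := v01 i.
  by rewrite ltnS -(ler_nat R) (le_trans (_ : _ <= tnth t i * k.+1%:R))//
    ?ler_piMl// truncn_le mulr_ge0.
pose p : {ffun 'I_n -> 'I_k.+2} := [ffun i => Ordinal (lt_idx i)].
have pP i : (p i)%:R / k.+1%:R <= tnth t i < (p i).+1%:R / k.+1%:R.
  rewrite ler_pdivrMr// ltr_pdivlMr// ffunE; apply: truncn_itv.
  by have /andP[t0 _] := v01 i; rewrite mulr_ge0.
have tp : box k p t by move=> i; rewrite /= in_itv/=; exact: pP.
have -> : h k t = f (g k p).
  rewrite /h (bigD1 p)//= indicE mem_set// mulr1 big1 ?addr0// => q qp.
  rewrite indicE memNset ?mulr0// => tq; move/eqP: qp; apply.
  apply/ffunP => i; apply/val_inj; rewrite ffunE /=.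
  apply/esym/truncn_def; have := tq i.
  by rewrite /= in_itv/= ler_pdivrMr// ltr_pdivlMr.
rewrite -mulrA; apply: (@le_trans _ _ (L * l2norm (g k p - v))).
  apply: fL => // i; rewrite mxE; have /andP[pi _] := pP i; have /andP[_ t1] := v01 i.
  by rewrite divr_ge0//= (le_trans pi).
rewrite ler_wpM2l//; apply: l2norm_le => [|i]; first by rewrite invr_ge0.
rewrite !mxE distrC; have /andP[p1 p2] := pP i.
rewrite ger0_norm ?subr_ge0// lerBlDl (le_trans (ltW p2))//.
by rewrite -natr1 mulrDl mul1r.
Qed.

End cube_measurability.

(** * Building families of mixed partial derivatives *)

Section family_constructions.
Context {R : realType} (n : nat) (E : set 'cV[R]_n).
Implicit Types (D : {set 'I_n} -> 'cV[R]_n -> R) (u : {set 'I_n}).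

Lemma partial_family_cst (c : R) :
  partial_family E (fun u _ => if u == finset.set0 then c else 0).
Proof.
move=> j z Ez u ju; rewrite (_ : (j |: u == _) = false).
  exact: is_derive_cst.
by apply/negbTE/set0Pn; exists j; rewrite !inE eqxx.
Qed.

Lemma partial_familyB D1 D2 : partial_family E D1 -> partial_family E D2 ->
  partial_family E (fun u z => D1 u z - D2 u z).
Proof.
move=> h1 h2 j z Ez u ju.
exact: is_deriveB (h1 j z Ez u ju) (h2 j z Ez u ju).
Qed.

Lemma partial_familyD D1 D2 : partial_family E D1 -> partial_family E D2 ->
  partial_family E (fun u z => D1 u z + D2 u z).
Proof.
move=> h1 h2 j z Ez u ju.
exact: is_deriveD (h1 j z Ez u ju) (h2 j z Ez u ju).
Qed.

Lemma partial_family_comb (J : finType) (c : J -> R)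
    (D : J -> {set 'I_n} -> 'cV[R]_n -> R) :
  (forall k, partial_family E (D k)) ->
  partial_family E (fun u z => \sum_k c k * D k u z).
Proof.
move=> h j z Ez u ju; apply: is_derive_sumr => k _.
exact: is_deriveZ (h k j z Ez u ju).
Qed.

Lemma partial_family_conv D1 D2 : partial_family E D1 -> partial_family E D2 ->
  partial_family E (fun u z => subset_conv (D1^~ z) (D2^~ z) u).
Proof.
move=> h1 h2 j z Ez.
exact: subset_conv_derives (h1 j z Ez) (h2 j z Ez).
Qed.

Lemma partial_family_apply (F : nat -> R -> R) D : partial_family E D ->
  (forall k z, E z -> is_derive (D finset.set0 z) 1 (F k) (F k.+1 (D finset.set0 z))) ->
  partial_family E (fun u z => conv_apply (F ^~ (D finset.set0 z)) (D^~ z) u).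
Proof.
move=> hD hF j z Ez.
apply: (@conv_apply_derives _ _ j 0 F _ (hD j z Ez)) => k.
by rewrite scale0r addr0; exact: hF.
Qed.

Definition coord_family (i : 'I_n) (q dq : R -> R) u (z : 'cV[R]_n) : R :=
  if u == finset.set0 then q (z i 0)
  else if u == [set i]%SET then dq (z i 0) else 0.

Lemma partial_family_coord (i : 'I_n) (q dq : R -> R) :
  (forall z, E z -> is_derive (z i 0) 1 q (dq (z i 0))) ->
  partial_family E (coord_family i q dq).
Proof.
move=> hq j z Ez u ju; rewrite /coord_family scale0r addr0.
have ju0 : (j |: u == finset.set0) = false.
  by apply/negbTE/set0Pn; exists j; rewrite !inE eqxx.
have const (f : R -> R) : j != i -> is_derive (0 : R) 1
    (fun t => f ((z + t *: delta_mx j 0) i 0)) 0.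
  move=> ji; rewrite (_ : (fun _ => _) = cst (f (z i 0))); first exact: is_derive_cst.
  by apply/funext => t; rewrite !mxE eq_sym (negbTE ji) mulr0 addr0.
rewrite ju0; case: eqVneq => [->|u0].
  rewrite finset.setU0; case: (eqVneq j i) => [->|ji]; last first.
    rewrite (_ : (_ == _) = false); first exact: const.
    by apply/negbTE; apply: contra ji => /eqP/finset.set1_inj ->.
  rewrite eqxx.
  have hs : is_derive (0 : R) 1 (fun t : R => t + z i 0) (1 + 0).
    exact: is_deriveD.
  have hq' : is_derive (0 + z i 0) 1 q (dq (z i 0)) by rewrite add0r; exact: hq.
  have := @is_derive1_comp R q (fun t => t + z i 0) 0 _ _ hq' hs.
  rewrite addr0 mulr1; congr (is_derive _ _ _ _); apply/funext => t /=.
  by rewrite !mxE !eqxx mulr1 addrC.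
have -> : (j |: u == [set i]%SET) = false.
  apply/negbTE; apply: contra u0 => /eqP jui.
  have ji : j = i by apply/set1P; rewrite -jui !inE eqxx.
  apply/set0Pn => -[k ku]; have : k \in [set i]%SET by rewrite -jui !inE ku orbT.
  by rewrite inE => /eqP ki; rewrite -ji in ki; rewrite -ki ku in ju.
case: (eqVneq u [set i]%SET) => [ui|_]; last exact: is_derive_cst.
by apply: const; apply: contra ju => /eqP ->; rewrite ui inE.
Qed.

End family_constructions.

(** For a function of some of the coordinates only, the derivatives in the other
    variables vanish. *)
Section block_families.
Context {R : realType} (n p : nat) (s : 'I_p -> 'I_n).
Hypothesis s_inj : injective s.

Definition block (y : 'cV[R]_n) : 'cV[R]_p := \col_i y (s i) 0.

Definition block_family (D : {set 'I_p} -> 'cV[R]_p -> R) (u : {set 'I_n})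
    (y : 'cV[R]_n) : R :=
  if u \subset codom s then D (s @^-1: u) (block y) else 0.

Lemma partial_family_block (E : set 'cV[R]_n) (E' : set 'cV[R]_p) D :
  (forall y, E y -> E' (block y)) -> partial_family E' D ->
  partial_family E (block_family D).
Proof.
move=> EE' hD j y Ey u ju; rewrite /block_family scale0r addr0.
have subU : (j |: u \subset codom s) = (j \in codom s) && (u \subset codom s).
  apply/fintype.subsetP/andP => [h|[js us] k].
    split; first by apply: h; rewrite !inE eqxx.
    by apply/fintype.subsetP => k ku; apply: h; rewrite !inE ku orbT.
  by rewrite !inE => /orP[/eqP -> //|]; exact: (fintype.subsetP us).
rewrite subU; case: (boolP (u \subset codom s)) => us; last first.
  by rewrite andbF; exact: is_derive_cst.
rewrite andbT; case: (boolP (j \in codom s)) => [/codomP[i ji]|js]; last first.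
  rewrite (_ : (fun _ => _) = cst (D (s @^-1: u) (block y))); first exact: is_derive_cst.
  apply/funext => t; congr D; apply/matrixP => k l; rewrite !mxE [_ == j](_ : _ = false).
    by rewrite mulr0 addr0.
  by apply/negbTE; apply: contra js => /eqP <-; exact: codom_f.
have iu : i \notin s @^-1: u by rewrite inE -ji.
have -> : s @^-1: (j |: u) = i |: s @^-1: u.
  by apply/setP => k; rewrite !inE ji (inj_eq s_inj).
have := hD i (block y) (EE' y Ey) _ iu; rewrite scale0r addr0.
congr (is_derive _ _ _ _); apply/funext => t; congr D; apply/matrixP => k l.
by rewrite !mxE ji (inj_eq s_inj) ord1.
Qed.

End block_families.

(** * Measurability of convolutions *)

Section measurable_convolution.
Context {R : realType} (I : finType) d (Y : measurableType d) (B : set Y).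
Implicit Types a b : Y -> {set I} -> R.

Lemma measurable_subset_conv a b u :
  (forall w, measurable_fun B (a ^~ w)) -> (forall w, measurable_fun B (b ^~ w)) ->
  measurable_fun B (fun y => subset_conv (a y) (b y) u).
Proof.
move=> ma mb.
rewrite (_ : (fun _ => _) = (fun y => \sum_(w : {set I})
    if w \subset u then a y w * b y (u :\: w) else 0)); last first.
  by apply/funext => y; rewrite /subset_conv big_mkcond.
apply: measurable_sum => w; case: (w \subset u); last exact: measurable_cst.
by apply: measurable_funM.
Qed.

Lemma measurable_conv_pow a k u : (forall w, measurable_fun B (a ^~ w)) ->
  measurable_fun B (fun y => conv_pow (a y) k u).
Proof.
move=> ma; elim: k u => [|k IH] u; first exact: measurable_cst.
apply: (@measurable_subset_conv (fun y => drop_set0 (a y)) (fun y => conv_pow (a y) k)) => // w.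
by rewrite /drop_set0; case: (w == _); [exact: measurable_cst|exact: ma].
Qed.

Lemma measurable_conv_apply (F : nat -> R -> R) a u :
  (forall w, measurable_fun B (a ^~ w)) ->
  (forall k, measurable_fun setT (F k)) ->
  measurable_fun B (fun y => conv_apply (F ^~ (a y finset.set0)) (a y) u).
Proof.
move=> ma mF; apply: measurable_sum => k; apply: measurable_funM.
  apply: measurable_funM; last exact: measurable_cst.
  exact: (measurableT_comp (mF k) (ma finset.set0)).
exact: measurable_conv_pow.
Qed.

End measurable_convolution.

(** * Distance to the boundary of the cube *)

Section edge_weights.
Context {R : realType} (n : nat).
Implicit Types (y : 'cV[R]_n) (i : 'I_n).

Definition edge_dist y i : R := Num.min (y i 0) (1 - y i 0).

Definition edge_weight y i : R := (edge_dist y i)^-1.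

Definition quantile_size y : R := \prod_i (1 + `|std_normal_icdf (y i 0)|).

Lemma edge_dist_gt0 y i : open_cube y -> 0 < edge_dist y i.
Proof. by move=> /(_ i) yi; rewrite lt_min; lra. Qed.

Lemma edge_weight_ge1 y i : open_cube y -> 1 <= edge_weight y i.
Proof.
move=> yE; rewrite invf_ge1 ?edge_dist_gt0//.
by rewrite ge_min; have /andP[_ /ltW ->] := yE i.
Qed.

Lemma quantile_size_ge1 y : 1 <= quantile_size y.
Proof.
rewrite /quantile_size; elim/big_ind : _ => // [a b a1 b1|i _].
  by rewrite -[leLHS]mulr1 ler_pM.
by rewrite lerDl.
Qed.

Lemma icdf_le_quantile_size y i : `|std_normal_icdf (y i 0)| <= quantile_size y.
Proof.
rewrite /quantile_size (bigD1 i)//=; apply: (@le_trans _ _ (1 + `|std_normal_icdf (y i 0)|)).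
  by rewrite lerDr.
rewrite ler_peMr ?addr_ge0//; elim/big_ind : _ => // [a b a1 b1|k _].
  by rewrite -[leLHS]mulr1 ler_pM.
by rewrite lerDl.
Qed.

Lemma quantile_size_growth (A : 'I_n -> R) (N : nat) : (forall i, 0 < A i) ->
  exists2 K : R, 0 < K & forall y, open_cube y ->
    quantile_size y ^+ N <= K * \prod_i edge_dist y i `^ (- A i).
Proof.
move=> A0.
have /choice[K hK] : forall i, exists K : R, 0 < K /\ forall t, 0 < t < 1 ->
    (1 + `|std_normal_icdf t|) ^+ N <= K * Num.min t (1 - t) `^ (- A i).
  by move=> i; have [K] := icdf_growth N (A0 i); exists K.
exists (\prod_i K i); first by rewrite prodr_gt0// => i _; have [] := hK i.
move=> y yE; rewrite /quantile_size -prodrXl -big_split /=.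
apply: ler_prod => i _; rewrite exprn_ge0 ?addr_ge0//=.
by have [_] := hK i; apply; exact: yE.
Qed.

(** Moving [y_j] by less than half its distance to the boundary keeps at least half
    of that distance. *)
Lemma edge_weight_segment y (j : 'I_n) t : open_cube y ->
  `|t| < edge_dist y j / 2 ->
  open_cube (y + t *: delta_mx j 0) /\
  forall i, edge_weight (y + t *: delta_mx j 0) i <= 2 * edge_weight y i.
Proof.
move=> yE; rewrite ltr_norml => /andP[t1 t2].
have coordE i : (y + t *: delta_mx j 0) i 0 = y i 0 + (if i == j then t else 0).
  by rewrite !mxE eqxx andbT; case: eqP => _; rewrite ?mulr1 ?mulr0.
have ej := edge_dist_gt0 j yE.
have ejl : edge_dist y j <= y j 0 by rewrite ge_min lexx.
have ejr : edge_dist y j <= 1 - y j 0 by rewrite ge_min lexx orbT.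
have y'E : open_cube (y + t *: delta_mx j 0).
  move=> i; rewrite coordE; case: eqP => [->|_]; last by rewrite addr0; exact: yE.
  by apply/andP; split; lra.
split => // i; have ei := edge_dist_gt0 i yE; have ei' := edge_dist_gt0 i y'E.
rewrite /edge_weight -[2]invrK -invfM lef_pV2 ?posrE ?mulr_gt0 ?invr_gt0//.
rewrite {2}/edge_dist coordE le_min; case: eqP => [->|_].
  by apply/andP; split; lra.
have h1 : edge_dist y i <= y i 0 by rewrite ge_min lexx.
have h2 : edge_dist y i <= 1 - y i 0 by rewrite ge_min lexx orbT.
by apply/andP; split; lra.
Qed.

End edge_weights.

(** * Positive definite matrices *)

Section quadratic_form.
Context {R : realType} (m : nat).
Implicit Types (S : 'M[R]_m) (v : 'cV[R]_m).

Lemma invmx_norm2_ge0 S v : posdefmx S -> 0 <= invmx_norm2 S v.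
Proof.
move=> [ST Spos]; have [->|v0] := eqVneq v 0.
  by rewrite /invmx_norm2 mulmx0 mxE.
rewrite /invmx_norm2; case: (boolP (S \in unitmx)) => Su; last first.
  (* For a singular matrix [invmx] is the identity function. *)
  by rewrite invmx_out// ltW// Spos.
have -> : v^T *m invmx S *m v = (invmx S *m v)^T *m S *m (invmx S *m v).
  by rewrite trmx_mul trmx_inv ST !mulmxA mulmxKV.
have [->|w0] := eqVneq (invmx S *m v) 0; first by rewrite mulmx0 mxE.
exact/ltW/Spos.
Qed.

Lemma invmx_norm2E S v :
  invmx_norm2 S v = \sum_(p : 'I_m * 'I_m) invmx S p.1 p.2 * (v p.1 0 * v p.2 0).
Proof.
rewrite /invmx_norm2 mxE -(pair_bigA _ (fun a b => invmx S a b * (v a 0 * v b 0))) /=.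
rewrite exchange_big; apply: eq_bigr => b _; rewrite mxE mulr_suml.
by apply: eq_bigr => a _; rewrite mxE; ring.
Qed.

Lemma coord_le_l2norm v i : `|v i 0| <= l2norm v.
Proof.
rewrite -sqrtr_sqr; apply: ler_wsqrtr; rewrite (bigD1 i)//= lerDl.
by apply: sumr_ge0 => k _; exact: sqr_ge0.
Qed.

End quadratic_form.

Section positive_definite_det.
Context {R : realType} (m : nat).

(** The characteristic polynomial of [- S] is positive near plus infinity and has
    no root in [0, +oo[, as its opposite would be a nonpositive eigenvalue of
    [S].  So its value at 0, which is the determinant of [S], is positive. *)
Lemma posdefmx_det_gt0 (S : 'M[R]_m) : posdefmx S -> 0 < \det S.
Proof.
move=> [ST Spos]; pose p := char_poly (- S).
have p_root t : 0 <= t -> ~~ root p t.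
  move=> t0; rewrite -eigenvalue_root_char; apply/eigenvalueP => -[v vS v0].
  have vT0 : v^T != 0 by apply: contra v0 => /eqP v0; rewrite -[v]trmxK v0 trmx0.
  have := Spos v^T vT0.
  have -> : v^T^T *m S *m v^T = - t *: (v *m v^T).
    rewrite trmxK; have -> : v *m S = - t *: v by rewrite scaleNr -vS mulmxN opprK.
    by rewrite scalemxAl.
  rewrite !mxE mulNr oppr_gt0 ltNge mulr_ge0// sumr_ge0// => i _.
  by rewrite mxE -expr2 sqr_ge0.
have p0 : p.[0] = \det S.
  rewrite horner_coef0 char_poly_det -[- S]scaleN1r detZ mulrA -exprD addnn.
  by rewrite -mul2n exprM sqrrN expr1n expr1n mul1r.
rewrite -p0 ltNge; apply/negP => p0_le.
have lp : 0 < lead_coef p by rewrite (monicP (char_poly_monic _)).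
have [b hb] := polyrcf.poly_pinfty_gt_lc lp.
pose c := Num.max b 0.
have pc : 0 <= p.[c] by rewrite (le_trans (ltW lp))// hb// le_max lexx.
have c0 : 0 <= c by rewrite le_max lexx orbT.
have [|x] := @polyrcf.poly_ivt R p 0 c c0; first by rewrite mulr_le0_ge0.
by rewrite in_itv/= => /andP[x0 _]; exact/negP/p_root.
Qed.

End positive_definite_det.

(** * Mixed derivatives of the log-evidence *)

Section log_evidence_families.
Context {R : realType} (d1 d2 : nat) (d21 : (d2 < d1)%N)
  (Sigma : 'M[R]_(d1 - d2)) (G : 'cV[R]_d2 -> 'cV[R]_(d1 - d2))
  (L : R) (DG : {set 'I_d2} -> 'cV[R]_d2 -> 'cV[R]_(d1 - d2)).
Hypotheses (Sigma_pos : posdefmx Sigma) (L_ge0 : 0 <= L)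
  (DG_partials : mixed_partials (@closed_cube R d2) G DG)
  (DG_le : forall z (u : {set 'I_d2}), closed_cube z -> l2norm (DG u z) <= L)
  (G_lip : forall z z' : 'cV[R]_d2, closed_cube z -> closed_cube z' ->
     l2norm (G z - G z') <= L * l2norm (z - z')).
Implicit Types (y : 'cV[R]_d1) (x : 'cV[R]_d2) (u : {set 'I_d1}).

Local Notation m := (d1 - d2)%N.
Local Notation E := (@open_cube R d1).
Local Notation icdf := (@std_normal_icdf R).
Local Notation cube := ((@cV_of_tuple R d2) @^-1` @closed_cube R d2).

Definition fst_index (i : 'I_d2) : 'I_d1 := widen_ord (ltnW d21) i.

Definition snd_index (k : 'I_m) : 'I_d1 :=
  cast_ord (subnKC (ltnW d21)) (rshift d2 k).

Definition mean_family (a : 'I_m) u y : R :=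
  block_family fst_index (fun v z => DG v z a 0) u y +
  \sum_k sqrtmx Sigma a k *
    coord_family (snd_index k) icdf (fun t => (normal_pdf 0 1 (icdf t))^-1) u y.

Definition residual_family x (a : 'I_m) u y : R :=
  mean_family a u y - (if u == finset.set0 then G x a 0 else 0).

Definition exponent_family x u y : R :=
  \sum_(p : 'I_m * 'I_m) (- 2^-1 * invmx Sigma p.1 p.2) *
    subset_conv (residual_family x p.1 ^~ y) (residual_family x p.2 ^~ y) u.

Definition norm_cst : R := (Num.sqrt (\det ((2 * pi) *: Sigma)))^-1.

Definition likelihood_family x u y : R :=
  conv_apply (fun=> norm_cst * expR (exponent_family x finset.set0 y))
    (exponent_family x ^~ y) u.

Definition evidence_family u y : R :=
  \int[lebesgue_tuple R d2]_(t in cube) likelihood_family (cV_of_tuple t) u y.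

Definition ln_derivative (k : nat) (h : R) : R :=
  if k is k'.+1 then (-1) ^+ k' * k'`!%:R * h ^- k'.+1 else ln h.

Definition log_family u y : R :=
  conv_apply (ln_derivative ^~ (evidence_family finset.set0 y))
    (evidence_family ^~ y) u.

Lemma open_cube_fst_block y : open_cube y -> open_cube (block fst_index y).
Proof. by move=> yE i; rewrite mxE; exact: yE. Qed.

Lemma open_cube_closed p (z : 'cV[R]_p) : open_cube z -> closed_cube z.
Proof. by move=> zE i; have /andP[/ltW -> /ltW ->] := zE i. Qed.

Lemma mean_family_partial a : partial_family E (mean_family a).
Proof.
apply: partial_familyD.
  apply: (@partial_family_block _ _ _ _ _ _ (@open_cube R d2)).
  - by move=> i k /(congr1 val)/= ik; exact: val_inj.
  - exact: open_cube_fst_block.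
  apply: (mixed_partials_coord _ DG_partials (@open_cube_closed d2)) => z j zE.
  have e0 : 0 < edge_dist z j / 2 by rewrite divr_gt0// edge_dist_gt0.
  exists (edge_dist z j / 2) => //= h hz.
  have {}hz : `|h| < edge_dist z j / 2 by rewrite -normrN -[- h]sub0r.
  by have [+ _] := edge_weight_segment zE hz => /open_cube_closed.
apply: partial_family_comb => k; apply: partial_family_coord => y yE.
exact/is_derive_std_normal_icdf/yE.
Qed.

Lemma mean_family0 a y : open_cube y -> mean_family a finset.set0 y =
  (G (fst_block d21 y) + sqrtmx Sigma *m map_mx icdf (snd_block d21 y)) a 0.
Proof.
move=> yE; rewrite mxE /mean_family /block_family.
rewrite (introT fintype.subsetP) => [|i]; last by rewrite inE.
rewrite preimset0.
rewrite (proj1 DG_partials); last exact/open_cube_closed/open_cube_fst_block.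
congr (_ + _); rewrite mxE; apply: eq_bigr => k _.
by rewrite /coord_family eqxx !mxE.
Qed.

Lemma residual_family_partial x a : partial_family E (residual_family x a).
Proof. exact/partial_familyB/partial_family_cst/mean_family_partial. Qed.

Lemma exponent_family_partial x : partial_family E (exponent_family x).
Proof.
apply: partial_family_comb => p.
by apply: partial_family_conv; exact: residual_family_partial.
Qed.

Lemma exponent_family0 x y : open_cube y -> exponent_family x finset.set0 y =
  - 2^-1 * invmx_norm2 Sigma (G (fst_block d21 y) +
    sqrtmx Sigma *m map_mx icdf (snd_block d21 y) - G x).
Proof.
move=> yE; rewrite invmx_norm2E mulr_sumr; apply: eq_bigr => p _.
rewrite subset_conv_set0 /residual_family eqxx !mean_family0//.
rewrite [in RHS]mulrA; congr (_ * (_ * _)).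
  by rewrite [RHS]mxE [X in _ = _ + X]mxE.
by rewrite [RHS]mxE [X in _ = _ + X]mxE.
Qed.

Lemma likelihood_family_partial x : partial_family E (likelihood_family x).
Proof.
have hF (k : nat) y : E y -> is_derive (exponent_family x finset.set0 y) 1
    (fun t => norm_cst * expR t) (norm_cst * expR (exponent_family x finset.set0 y)).
  by move=> _; exact: is_deriveZ (is_derive_expR _).
exact: (@partial_family_apply _ _ _ (fun (_ : nat) t => norm_cst * expR t) _
  (@exponent_family_partial x) hF).
Qed.

Lemma likelihood_family0 x y : open_cube y ->
  likelihood_family x finset.set0 y = likelihood d21 Sigma G y x.
Proof. by move=> yE; rewrite /likelihood_family conv_apply_set0 exponent_family0. Qed.

Lemma evidence_family0 y : open_cube y ->
  evidence_family finset.set0 y = cube_integral (likelihood d21 Sigma G y).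
Proof. by move=> yE; apply: eq_Rintegral => t _; rewrite likelihood_family0. Qed.

Lemma measurable_likelihood_family u y :
  measurable_fun (cube : set (d2.-tuple (measurableTypeR R)))
    (fun t => likelihood_family (cV_of_tuple t) u y).
Proof.
apply: (@measurable_conv_apply _ _ _ _ _ (fun (_ : nat) t => norm_cst * expR t)
  (fun t => exponent_family (cV_of_tuple t) ^~ y)) => [v|_]; last first.
  by apply: measurable_funM => //; exact: measurable_cst.
apply: measurable_sum => p; apply: measurable_funM; first exact: measurable_cst.
have mres (a : 'I_m) w : measurable_fun (cube : set (d2.-tuple (measurableTypeR R)))
    (fun t => residual_family (cV_of_tuple t) a w y).
  rewrite /residual_family; case: (w == _); last exact: measurable_cst.
  apply: measurable_funB; first exact: measurable_cst.
  apply: (@measurable_cube_lipschitz _ _ (fun x => G x a 0) L) => // z z' zE z'E.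
  apply: le_trans (G_lip zE z'E).
  by have := coord_le_l2norm (G z - G z') a; rewrite !mxE.
by apply: (@measurable_subset_conv _ _ _ _ _
  (fun t => residual_family (cV_of_tuple t) p.1 ^~ y)
  (fun t => residual_family (cV_of_tuple t) p.2 ^~ y)) => w; exact: mres.
Qed.

Lemma coord_family_icdf_bounded :
  exists2 K : R, 0 <= K & forall y i, open_cube y ->
    weight_bounded (edge_weight y)
      (coord_family i icdf (fun t => (normal_pdf 0 1 (icdf t))^-1) ^~ y)
      (K * quantile_size y).
Proof.
have [C C0 hC] := @inv_pdf_icdf_le R.
exists (1 + C) => [|y i yE u]; first by lra.
have w1 := weight_ge1 (fun k => edge_weight_ge1 k yE) u.
have M1 := quantile_size_ge1 y; have Mi := icdf_le_quantile_size y i.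
have CM0 : 0 <= C * quantile_size y by rewrite mulr_ge0//; lra.
rewrite /coord_family; case: eqVneq => [->|_].
  rewrite big1 ?mulr1; last by move=> k; rewrite inE.
  by rewrite mulrDl mul1r; lra.
case: eqVneq => [->|_]; last first.
  by rewrite normr0 !mulr_ge0//; lra.
rewrite big_set1 ger0_norm; last by rewrite invr_ge0 ltW// std_normal_pdf_gt0.
apply: (le_trans (hC _ (yE i))); rewrite ler_wpM2r//.
  by rewrite invr_ge0 ltW// edge_dist_gt0.
by rewrite mulrDl; nra.
Qed.

Lemma residual_family_bounded :
  exists2 K : R, 0 <= K & forall x a y, closed_cube x -> open_cube y ->
    weight_bounded (edge_weight y) (residual_family x a ^~ y)
      (K * quantile_size y).
Proof.
have [C C0 hC] := coord_family_icdf_bounded.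
pose T := \sum_a \sum_k `|sqrtmx Sigma a k|.
have T0 : 0 <= T by apply: sumr_ge0 => a _; apply: sumr_ge0.
exists (L + T * C + L) => [|x a y xE yE]; first by rewrite !addr_ge0// mulr_ge0.
have w1 k := edge_weight_ge1 k yE; have M1 := quantile_size_ge1 y.
have LM : L <= L * quantile_size y by rewrite ler_peMr.
have Ta : \sum_k `|sqrtmx Sigma a k| <= T.
  by rewrite /T [leRHS](bigD1 a)//= lerDl; apply: sumr_ge0 => b _; apply: sumr_ge0.
rewrite !mulrDl -mulrA; apply: weight_boundedB; first apply: weight_boundedD.
- apply: weight_bounded_cst => // u; apply: le_trans LM.
  rewrite /block_family; case: ifP => _; last by rewrite normr0.
  apply: le_trans (DG_le _ _); first exact: coord_le_l2norm.
  exact/open_cube_closed/open_cube_fst_block.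
- apply: weight_bounded_le (weight_bounded_comb _ (fun k => hC y (snd_index k) yE)) => //.
  by rewrite ler_wpM2r// mulr_ge0//; lra.
- apply: weight_bounded_cst => // u; apply: le_trans LM.
  case: ifP => _; last by rewrite normr0.
  rewrite -(proj1 DG_partials x xE).
  exact: le_trans (coord_le_l2norm _ _) (DG_le _ xE).
Qed.

Lemma exponent_family_bounded :
  exists2 K : R, 0 <= K & forall x y, closed_cube x -> open_cube y ->
    weight_bounded (edge_weight y) (exponent_family x ^~ y)
      (K * quantile_size y ^+ 2).
Proof.
have [C C0 hC] := residual_family_bounded.
pose T := \sum_(p : 'I_m * 'I_m) `|- 2^-1 * invmx Sigma p.1 p.2|.
exists (T * (2 ^+ #|'I_d1| * C * C)) => [|x y xE yE].
  by rewrite !mulr_ge0 ?exprn_ge0//; apply: sumr_ge0.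
have w1 k := edge_weight_ge1 k yE; have M1 := quantile_size_ge1 y.
have CM0 : 0 <= C * quantile_size y by rewrite mulr_ge0//; lra.
have h : weight_bounded (edge_weight y) (exponent_family x ^~ y)
    (T * (2 ^+ #|'I_d1| * (C * quantile_size y) * (C * quantile_size y))).
  by apply: weight_bounded_comb => p; apply: weight_bounded_conv => //; exact: hC.
by apply: weight_bounded_le h => //; rewrite expr2 le_eqVlt; apply/orP; left; apply/eqP; ring.
Qed.

Lemma norm_cst_ge0 : 0 <= norm_cst.
Proof. by rewrite invr_ge0 sqrtr_ge0. Qed.

Lemma likelihood_ge0 x y : 0 <= likelihood d21 Sigma G y x.
Proof. by rewrite mulr_ge0 ?norm_cst_ge0 ?expR_ge0. Qed.

Lemma likelihood_le x y : likelihood d21 Sigma G y x <= norm_cst.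
Proof.
rewrite /likelihood -/norm_cst ler_piMr ?norm_cst_ge0// -[leRHS]expR0 ler_expR.
by rewrite mulNr oppr_le0 mulr_ge0 ?invmx_norm2_ge0// invr_ge0.
Qed.

(** The density itself is a factor of the bound; after integration in [x] it
    becomes the evidence, by which the logarithmic derivatives divide. *)
Lemma likelihood_family_bounded :
  exists2 K : R, 0 <= K & forall x y, closed_cube x -> open_cube y ->
    weight_bounded (edge_weight y) (likelihood_family x ^~ y)
      (K * quantile_size y ^+ (2 * d1) * likelihood d21 Sigma G y x).
Proof.
have [C C0 hC] := exponent_family_bounded.
exists (d1.+1%:R * (2 ^+ d1 * (1 + C)) ^+ d1) => [|x y xE yE u].
  by rewrite !mulr_ge0// exprn_ge0// mulr_ge0// ?exprn_ge0//; lra.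
have M1 := quantile_size_ge1 y; have w1 k := edge_weight_ge1 k yE.
have M2 : 1 <= quantile_size y ^+ 2 by rewrite exprn_ege1.
have := @weight_bounded_conv_apply _ _ _ w1
  (fun=> norm_cst * expR (exponent_family x finset.set0 y))
  (exponent_family x ^~ y) 1 ((1 + C) * quantile_size y ^+ 2)
  (likelihood d21 Sigma G y x) ler01.
rewrite card_ord => h; apply: le_trans (h _ _ _ u) _.
- by nra.
- rewrite mul1r; apply: (weight_bounded_le w1 _ (hC x y xE yE)).
  by rewrite ler_wpM2r//; lra.
- move=> k _; rewrite expr1n mulr1 exponent_family0//.
  by rewrite ger0_norm// likelihood_ge0.
rewrite le_eqVlt; apply/orP; left; apply/eqP.
by rewrite mulrA [in LHS]exprMn exprM; ring.
Qed.

(** Along a short segment in direction [j] the weights at most double, and the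
    density is bounded, so the estimate of the likelihood is locally uniform. *)
Lemma likelihood_family_locally_bounded u (j : 'I_d1) y : open_cube y ->
  exists2 e : R, 0 < e & exists C : R, forall t, `|t| < e ->
    open_cube (y + t *: delta_mx j 0) /\
    forall s, cube s ->
      `|likelihood_family (cV_of_tuple s) u (y + t *: delta_mx j 0)| <= C.
Proof.
move=> yE; have [K K0 hK] := likelihood_family_bounded.
have [Q Q0 hQ] := @quantile_size_growth R d1 (fun=> 1) (2 * d1) (fun=> ltr01).
exists (edge_dist y j / 2); first by rewrite divr_gt0// edge_dist_gt0.
pose P := \prod_i (2 * edge_weight y i).
(* [Q * P] bounds the power of [quantile_size], and the last [P] the weights. *)
exists (K * (Q * P) * norm_cst * P) => t ht.
have [y'E hw] := edge_weight_segment yE ht; split => // s sE.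
set y' := y + t *: delta_mx j 0 in y'E hw *.
have w1 k := edge_weight_ge1 k y'E.
have w0 k : 0 <= edge_weight y' k by exact: le_trans (w1 k).
have prodP : \prod_i edge_weight y' i <= P.
  by apply: ler_prod => i _; rewrite hw w0.
have P0 : 0 <= P by apply: le_trans prodP; apply: prodr_ge0.
have uP : \prod_(i in u) edge_weight y' i <= P.
  apply: le_trans prodP; rewrite [leRHS](bigID [in u])/= ler_peMr ?prodr_ge0//.
  by elim/big_ind : _ => // a b a1 b1; rewrite -[leLHS]mulr1 ler_pM.
apply: (le_trans (hK _ _ sE y'E u)).
have M1 := quantile_size_ge1 y'.
apply: ler_pM => //; rewrite ?mulr_ge0 ?likelihood_ge0 ?exprn_ge0 ?prodr_ge0//; try lra.
apply: ler_pM => //; rewrite ?mulr_ge0 ?likelihood_ge0 ?exprn_ge0//; try lra; last first.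
  exact: likelihood_le.
rewrite ler_wpM2l//; apply: (le_trans (hQ _ y'E)); rewrite ler_wpM2l ?(ltW Q0)//.
apply: le_trans prodP; apply: ler_prod => i _; rewrite powR_ge0/=.
by rewrite powRN powRr1// ltW// edge_dist_gt0.
Qed.

Lemma lebesgue_tuple_cube_fin : (lebesgue_tuple R d2 cube < +oo)%E.
Proof. by rewrite lebesgue_tuple_cube ltry. Qed.

Lemma evidence_family_partial : partial_family E evidence_family.
Proof.
apply: partial_family_integral => [| |s sE|u y yE|u j y yE].
- exact: measurable_cube.
- exact: lebesgue_tuple_cube_fin.
- exact: likelihood_family_partial.
- exact: measurable_likelihood_family.
- exact: likelihood_family_locally_bounded.
Qed.

Lemma integrable_likelihood_family u y : open_cube y ->
  (lebesgue_tuple R d2).-integrable cube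
    (EFin \o (fun t => likelihood_family (cV_of_tuple t) u y)).
Proof.
move=> yE.
(* The local bound is used at the centre of a segment, in any direction. *)
have d1_gt0 : (0 < d1)%N by exact: leq_ltn_trans d21.
have [e e0 [C hC]] := likelihood_family_locally_bounded u (Ordinal d1_gt0) yE.
have [_] := hC 0 (etrans (congr1 (fun a => a < e) (normr0 _)) e0).
rewrite scale0r addr0 => {}hC.
exact: (bounded_integrable (@measurable_cube R d2) lebesgue_tuple_cube_fin
  (measurable_likelihood_family u y) hC).
Qed.

Lemma evidence_family_bounded :
  exists2 K : R, 0 <= K & forall y, open_cube y ->
    weight_bounded (edge_weight y) (evidence_family ^~ y)
      (K * quantile_size y ^+ (2 * d1) * evidence_family finset.set0 y).
Proof.
have [K K0 hK] := likelihood_family_bounded.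
exists K => // y yE u.
have mc := @measurable_cube R d2.
apply: (le_trans (le_normr_Rintegral mc (integrable_likelihood_family u yE))).
rewrite mulrAC /evidence_family -RintegralZl//; last exact: integrable_likelihood_family.
apply: le_Rintegral => //.
- exact/integrable_norm/integrable_likelihood_family.
- exact: (integrableZl mc
    (K * quantile_size y ^+ (2 * d1) * \prod_(i in u) edge_weight y i)
    (integrable_likelihood_family finset.set0 yE)).
move=> s sE; rewrite mulrAC likelihood_family0//.
exact: hK.
Qed.

Lemma norm_cst_gt0 : 0 < norm_cst.
Proof.
rewrite invr_gt0 sqrtr_gt0 detZ mulr_gt0 ?posdefmx_det_gt0//.
by rewrite exprn_gt0// mulr_gt0// pi_gt0.
Qed.

Lemma Rintegral_cube_cst (c : R) :
  \int[lebesgue_tuple R d2]_(t in cube) cst c t = c.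
Proof.
have cube1 : fine (lebesgue_tuple R d2 cube) = 1.
  exact: (congr1 fine (@lebesgue_tuple_cube R d2)).
by rewrite Rintegral_cst ?[fine _]cube1 ?mulr1//; exact: measurable_cube.
Qed.

Lemma integrable_cube_cst (c : R) :
  (lebesgue_tuple R d2).-integrable cube (EFin \o cst c).
Proof.
exact: (@bounded_integrable _ _ _ _ _ (@measurable_cube R d2)
  lebesgue_tuple_cube_fin (cst c) `|c| (measurable_cst c)).
Qed.

Lemma evidence_le y : open_cube y -> evidence_family finset.set0 y <= norm_cst.
Proof.
move=> yE; have mc := @measurable_cube R d2.
rewrite -(Rintegral_cube_cst norm_cst).
apply: le_Rintegral => //; first exact: integrable_likelihood_family.
  exact: integrable_cube_cst.
by move=> s _; rewrite likelihood_family0// likelihood_le.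
Qed.

Lemma evidence_ge : exists2 K : R, 0 <= K & forall y, open_cube y ->
  norm_cst * expR (- (K * quantile_size y ^+ 2)) <= evidence_family finset.set0 y.
Proof.
have [K K0 hK] := exponent_family_bounded; exists K => // y yE.
have mc := @measurable_cube R d2.
set b := norm_cst * _.
rewrite -(Rintegral_cube_cst b).
apply: le_Rintegral => //; last 2 first.
- exact: integrable_likelihood_family.
- move=> s sE; rewrite /likelihood_family conv_apply_set0.
  rewrite ler_wpM2l ?norm_cst_ge0// ler_expR.
  have := hK _ _ sE yE finset.set0.
  by rewrite big1 ?mulr1 => [/lerNnormlW //|k]; rewrite inE.
exact: integrable_cube_cst.
Qed.

Lemma evidence_gt0 y : open_cube y -> 0 < evidence_family finset.set0 y.
Proof.
have [K _ hK] := evidence_ge => yE; apply: lt_le_trans (hK y yE).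
by rewrite mulr_gt0 ?expR_gt0// norm_cst_gt0.
Qed.

Lemma ln_evidence_le : exists2 K : R, 0 <= K & forall y, open_cube y ->
  `|ln (evidence_family finset.set0 y)| <= K * quantile_size y ^+ 2.
Proof.
have [K K0 hK] := evidence_ge.
exists (`|ln norm_cst| + K) => [|y yE]; first exact: addr_ge0.
have M2 : 1 <= quantile_size y ^+ 2 by rewrite exprn_ege1// quantile_size_ge1.
have c0 := norm_cst_gt0; have e0 := evidence_gt0 yE.
have hl : ln norm_cst - K * quantile_size y ^+ 2 <= ln (evidence_family finset.set0 y).
  rewrite -[X in _ - X]opprK opprK -[X in _ + X]expRK -lnM ?posrE ?expR_gt0//.
  by rewrite ler_ln ?posrE ?mulr_gt0 ?expR_gt0// hK.
have hu : ln (evidence_family finset.set0 y) <= ln norm_cst.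
  by rewrite ler_ln ?posrE// evidence_le.
have nM : `|ln norm_cst| <= `|ln norm_cst| * quantile_size y ^+ 2 by rewrite ler_peMr.
have KM : 0 <= K * quantile_size y ^+ 2 by rewrite mulr_ge0//; lra.
have h1 := ler_norm (ln norm_cst); have h2 := lerNnormlW (lexx `|ln norm_cst|).
by rewrite ler_norml mulrDl; apply/andP; split; lra.
Qed.

Lemma is_derive_ln_derivative k (h : R) : 0 < h ->
  is_derive h 1 (ln_derivative k) (ln_derivative k.+1 h).
Proof.
move=> h0; case: k => [|k].
  by rewrite /= expr0 fact0 !mul1r expr1; exact: is_derive1_ln.
have hV : is_derive h 1 (fun t : R => t ^- k.+1) (- (h ^+ k.+1) ^- 2 *: (k.+1%:R * h ^+ k)).
  apply: is_deriveV; first by rewrite expf_neq0// gt_eqF.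
  rewrite -[_%:R * _]mulr1 (_ : (@GRing.exp R)^~ k.+1 = id ^+ k.+1).
    exact: is_deriveX.
  by apply/funext => t; rewrite exprfctE.
apply: (is_derive_eq (is_deriveZ ((-1) ^+ k * k`!%:R) hV)).
rewrite /GRing.scale/= factS natrM exprS.
have hk : h ^+ k.+1 = h * h ^+ k by rewrite exprS.
by rewrite !exprS; field; rewrite ?expf_neq0 ?gt_eqF.
Qed.

Lemma log_family_partial : partial_family E log_family.
Proof.
apply: partial_family_apply; first exact: evidence_family_partial.
by move=> k y yE; apply: is_derive_ln_derivative; exact: evidence_gt0.
Qed.

Lemma log_family0 y : open_cube y ->
  log_family finset.set0 y = log_evidence d21 Sigma G y.
Proof. by move=> yE; rewrite /log_family conv_apply_set0 /= evidence_family0. Qed.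

(** In the bound of [weight_bounded_conv_apply] the scale is the evidence [h]:
    [ln_derivative k h] times [h ^+ k] is a factorial up to sign for [k > 0], and
    [ln h] for [k = 0]. *)
Lemma log_family_bounded : exists N : nat, exists2 K : R, 0 <= K &
  forall y, open_cube y ->
    weight_bounded (edge_weight y) (log_family ^~ y) (K * quantile_size y ^+ N).
Proof.
have [C C0 hC] := evidence_family_bounded.
have [D D0 hD] := ln_evidence_le.
exists (2 + 2 * d1 * d1)%N.
exists (d1.+1%:R * (d1`!%:R + D) * (2 ^+ d1 * (1 + C)) ^+ d1) => [|y yE u].
  by rewrite !mulr_ge0 ?exprn_ge0 ?mulr_ge0 ?exprn_ge0 ?addr_ge0.
have w1 k := edge_weight_ge1 k yE.
have M1 := quantile_size_ge1 y; have h0 := evidence_gt0 yE.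
set M := quantile_size y in M1 *; set h := evidence_family finset.set0 y in h0.
have M2 : 1 <= M ^+ 2 by rewrite exprn_ege1.
have Md : 1 <= M ^+ (2 * d1) by rewrite exprn_ege1.
have := @weight_bounded_conv_apply _ _ _ w1 (ln_derivative ^~ h) (evidence_family ^~ y)
  h ((1 + C) * M ^+ (2 * d1)) ((d1`!%:R + D) * M ^+ 2) (ltW h0).
rewrite card_ord => H; apply: le_trans (H _ _ _ u) _.
- by rewrite -[leLHS]mulr1 ler_pM//; lra.
- apply: (weight_bounded_le w1 _ (hC y yE)).
  by rewrite -/M -/h mulrC ler_wpM2l ?(ltW h0)// ler_wpM2r ?lerDr//; lra.
- move=> [|k] kd /=.
    rewrite expr0 mulr1 (le_trans (hD y yE))// ler_wpM2r//.
      exact: le_trans M2.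
    by rewrite lerDr.
  rewrite !normrM normrX normrN1 expr1n mul1r normr_nat ger0_norm; last first.
    by rewrite invr_ge0 exprn_ge0// ltW.
  rewrite mulrVK ?unitfE ?expf_neq0 ?gt_eqF//.
  apply: (@le_trans _ _ (d1`!%:R + D)); last by rewrite ler_peMr// addr_ge0.
  by rewrite ler_wpDr// ler_nat leq_fact// ltnW.
rewrite le_eqVlt; apply/orP; left; apply/eqP.
have -> : M ^+ (2 + 2 * d1 * d1) = M ^+ 2 * (M ^+ (2 * d1)) ^+ d1.
  by rewrite exprD -exprM.
have -> : (2 ^+ d1 * ((1 + C) * M ^+ (2 * d1))) ^+ d1 =
    (2 ^+ d1 * (1 + C)) ^+ d1 * (M ^+ (2 * d1)) ^+ d1 by rewrite mulrA exprMn.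
ring.
Qed.

End log_evidence_families.

Theorem lemma1 (R : realType) (d1 d2 : nat) (d2_gt0 : (1 <= d2)%N)
    (d21 : (d2 < d1)%N) (Sigma : 'M[R]_(d1 - d2))
    (G : 'cV[R]_d2 -> 'cV[R]_(d1 - d2)) :
  posdefmx Sigma ->
  (exists (L : R) (DG : {set 'I_d2} -> 'cV[R]_d2 -> 'cV[R]_(d1 - d2)),
    [/\ 0 <= L,
        mixed_partials (@closed_cube R d2) G DG,
        forall z (u : {set 'I_d2}), closed_cube z -> l2norm (DG u z) <= L &
        forall z z' : 'cV[R]_d2, closed_cube z -> closed_cube z' ->
          l2norm (G z - G z') <= L * l2norm (z - z')]) ->
  exists Df : {set 'I_d1} -> 'cV[R]_d1 -> R,
    mixed_partials (@open_cube R d1) (log_evidence d21 Sigma G : _ -> R^o) Df /\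
    forall A : 'I_d1 -> R, (forall i, 0 < A i) ->
    exists2 b : R, 0 < b &
      forall (y : 'cV[R]_d1) (u : {set 'I_d1}), open_cube y ->
        `|Df u y| <=
          b * \prod_i Num.min (y i 0) (1 - y i 0) `^ (- A i - (i \in u)%:R).
Proof.
move=> Spos [L [DG [L0 hDG DG_le G_lip]]].
exists (log_family d21 Sigma G DG); split.
  apply: partial_family_mixed_partials; first exact: log_family_partial DG_le G_lip.
  by move=> y yE; exact: log_family0 hDG _ yE.
have [N [K K0 hK]] := log_family_bounded d21 Spos L0 hDG DG_le G_lip.
move=> A A0; have [Q Q0 hQ] := quantile_size_growth N A0.
exists ((K + 1) * Q) => [|y u yE]; first by rewrite mulr_gt0//; lra.
apply: (le_trans (hK y yE u)).
have -> : \prod_i Num.min (y i 0) (1 - y i 0) `^ (- A i - (i \in u)%:R) =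
    (\prod_i edge_dist y i `^ (- A i)) * \prod_(i in u) edge_weight y i.
  rewrite [X in _ * X]big_mkcond -big_split /=; apply: eq_bigr => i _.
  have e0 := edge_dist_gt0 i yE; rewrite -/(edge_dist y i) powRD; last first.
    by rewrite (gt_eqF e0) implybT.
  case: (i \in u) => /=; last by rewrite oppr0 powRr0.
  by rewrite [X in _ * X = _]powRN powRr1 ?(ltW e0)//; congr (_ * _).
rewrite mulrA ler_wpM2r//.
  by apply: prodr_ge0 => i _; rewrite invr_ge0 ltW// edge_dist_gt0.
rewrite -mulrA; apply: ler_pM => //; last exact: hQ.
  by rewrite exprn_ge0// (le_trans _ (quantile_size_ge1 y)).
by rewrite lerDl.
Qed.
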